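(* Let $X$ be a real random variable with a symmetric distribution and finite moments $E|X|^n<\infty$ of all orders $n\ge0$, and let $\phi_X(t)=E(e^{itX})$ be its characteristic function. Then for every $a>0$ and every complex $s$ with $\mathrm{Re}(s)>0$, $$\int_0^\infty t^{s-1}e^{-at}\phi_X(t)\,dt=\Gamma(s)E\big[(a+iX)^{-s}\big].$$ In particular, for any $a>0$, $$e^{-at}\phi_X(t)=\sum_{n=0}^\infty\frac{(-t)^nE\big[(a+iX)^n\big]}{n!},\quad t\ge0.$$
   Context: Complex powers of numbers with positive real part use the principal branch. Symmetric distribution means that $X$ and $-X$ have the same distribution.
   Formalization: The series formula fails for some X (e.g. symmetrized log-normal: divergence for all t>0). It is proved at each t≥0 where the series converges; convergence is shown if E e^{t|X|}<∞, and the series is always asymptotic to e^{-at}φ_X(t) as t→0+. *)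

(* Defs.v *)
From HB Require Import structures.
From mathcomp Require Import all_boot all_order all_algebra.
From mathcomp Require Import all_classical all_reals all_analysis.
From mathcomp Require Import complex.

Set Implicit Arguments.
Unset Strict Implicit.
Unset Printing Implicit Defensive.

Import Order.TTheory GRing.Theory Num.Theory.
Import numFieldNormedType.Exports.

Local Open Scope classical_set_scope.
Local Open Scope ring_scope.
Local Open Scope complex_scope.

Definition cexp {R : realType} (z : R[i]) : R[i] :=
  (expR (complex.Re z))%:C * (cos (complex.Im z) +i* sin (complex.Im z)).

(* Principal argument, with values in ]-pi, pi] for z != 0. *)
Definition carg {R : realType} (z : R[i]) : R :=
  if 0 <= complex.Im z then acos (complex.Re z / Normc.normc z)
  else - acos (complex.Re z / Normc.normc z).

Definition clog {R : realType} (z : R[i]) : R[i] :=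
  ln (Normc.normc z) +i* carg z.

(* Principal branch of z ^ s; the value at z = 0 is irrelevant. *)
Definition cpow {R : realType} (z s : R[i]) : R[i] := cexp (s * clog z).

Definition cintegrable d (T : measurableType d) (R : realType)
    (mu : {measure set T -> \bar R}) (D : set T) (f : T -> R[i]) : Prop :=
  mu.-integrable D (EFin \o (fun x => complex.Re (f x))) /\
  mu.-integrable D (EFin \o (fun x => complex.Im (f x))).

Definition cintegral d (T : measurableType d) (R : realType)
    (mu : {measure set T -> \bar R}) (D : set T) (f : T -> R[i]) : R[i] :=
  Rintegral mu D (fun x => complex.Re (f x)) +i* Rintegral mu D (fun x => complex.Im (f x)).

Definition cexpectation d (T : measurableType d) (R : realType)
    (P : probability T R) (Z : T -> R[i]) : R[i] := cintegral P setT Z.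

(* Euler's integral; meaningful for 0 < Re s. *)
Definition cGamma {R : realType} (s : R[i]) : R[i] :=
  cintegral (@lebesgue_measure R) `]0, +oo[
    (fun t => cpow t%:C (s - 1) * (expR (- t))%:C).

Definition char_fun d (T : measurableType d) (R : realType)
    (P : probability T R) (X : {RV P >-> R}) (t : R) : R[i] :=
  cexpectation P (fun w => cexp (0 +i* (t * X w))).

(* Two distributions are compared on measurable sets only: the value of a
   measure on a non-measurable set carries no information. *)
Definition symmetric_RV d (T : measurableType d) (R : realType)
    (P : probability T R) (X : {RV P >-> R}) : Prop :=
  forall A : set R, measurable A ->
    distribution P X A = pushforward P (fun w => - X w) A.

Definition finite_moments d (T : measurableType d) (R : realType)
    (P : probability T R) (X : {RV P >-> R}) : Prop :=
  forall n : nat, ('E_P[(fun w => `|X w| ^+ n)%R] < +oo)%E.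

(* Under finite_moments alone the series of these terms may diverge for every
   t > 0, e.g. when |X| is log-normal.  R[i]^o carries the topology given by
   the modulus. *)
Definition moment_term d (T : measurableType d) (R : realType)
    (P : probability T R) (X : {RV P >-> R}) (a t : R) (n : nat) : R[i]^o :=
  (- t)%:C ^+ n * cexpectation P (fun w => (a +i* X w) ^+ n) / n`!%:R.

(* Main.v *)
Require Import Defs.
From HB Require Import structures.
From mathcomp Require Import all_boot all_order all_algebra.
From mathcomp Require Import all_classical all_reals all_analysis.
From mathcomp Require Import complex ring lra.
From mathcomp Require Import measurable_realfun.

Import Order.TTheory GRing.Theory Num.Theory.
Import numFieldNormedType.Exports.

Local Open Scope classical_set_scope.
Local Open Scope ring_scope.
Local Open Scope complex_scope.

(** Write Z = a + iX.  As X is symmetric, phi_X(t) = E e^{-itX}, hence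
    e^{-at} phi_X(t) = E e^{-tZ}: the function to be studied is the Laplace transform of Z,
    whose values have real part a > 0.

    _The Mellin transform._  For Re s > 0 the modulus of t^{s-1} e^{-tZ} is the gamma density
    t^{Re s - 1} e^{-at}, which is integrable on the half-line and does not depend on the
    sample point.  Fubini's theorem ([dominated_cfubini]) therefore turns the Mellin transform
    of E e^{-tZ} into E F(Z), where F(z) is the integral of t^{s-1} e^{-tz} over t > 0
    ([mellin s z] below).  What remains is F(z) = Gamma(s) z^{-s} for Re z > 0
    ([mellin_pow]).  Along the segment from 1 to z the function F(zeta) zeta^s is constant:
    differentiation under the integral sign gives F'(zeta) = - F1(zeta)
    ([is_cderive_mellin]), where F1 is the integral of t^s e^{-t zeta}, and integrating the
    derivative of t^s e^{-t zeta} over the half-line gives s F(zeta) = zeta F1(zeta)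
    ([mellinS]).  The value at 1 is Gamma(s).

    _The series._  For Re z >= 0 and t >= 0 the Taylor remainder of e^{-tz} after N terms is
    at most |tz|^N / N! ([cexp_rem_le]).  Taking expectations bounds the difference between
    E e^{-tZ} and the N-th partial sum by a constant times t^N E(a + |X|)^N / N!, which is
    the asymptotic expansion ([moment_asymptotics]).  If E e^{t|X|} is finite this bound tends
    to 0, so the series converges to E e^{-tZ} ([moment_series_cvg]).

    Conversely, let the series converge at t > 0.  Its terms are bounded, and the binomial
    expansion of (iX)^n = (Z - a)^n bounds E X^{2k} t^{2k} / (2k)! uniformly in k
    ([even_moment_le]).  Comparison of cosh with a geometric series makes E e^{u|X|} finite
    for every u < t ([exp_moment_lty]), so the sum is E e^{-uZ} on [0, t[.  Abel's theorem
    ([abel_limit]) and the Lipschitz continuity of the Laplace transform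
    ([laplace_lipschitz]) carry the identity to the end point t. *)

(** * Complex numbers and the complex exponential *)

Section complex_facts.
Context {R : realType}.
Implicit Types (x y z s : R[i]) (a b t u : R).
Local Notation Re := (@complex.Re R).
Local Notation Im := (@complex.Im R).
Local Notation normc := (@Normc.normc R).

Lemma ReD x y : Re (x + y) = Re x + Re y. Proof. by case: x; case: y. Qed.
Lemma ImD x y : Im (x + y) = Im x + Im y. Proof. by case: x; case: y. Qed.
Lemma ReN x : Re (- x) = - Re x. Proof. by case: x. Qed.
Lemma ImN x : Im (- x) = - Im x. Proof. by case: x. Qed.
Lemma ReM x y : Re (x * y) = Re x * Re y - Im x * Im y.
Proof. by case: x; case: y. Qed.
Lemma ImM x y : Im (x * y) = Re x * Im y + Im x * Re y.
Proof. by case: x; case: y. Qed.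

Definition ReImE := (ReD, ImD, ReN, ImN, ReM, ImM).

Lemma complex_ext x y : Re x = Re y -> Im x = Im y -> x = y.
Proof. by case: x => ? ?; case: y => ? ? /= -> ->. Qed.

Lemma normc_sqrt x : normc x = Num.sqrt (Re x ^+ 2 + Im x ^+ 2).
Proof. by case: x. Qed.

Lemma normc_ge0 x : 0 <= normc x.
Proof. by rewrite normc_sqrt sqrtr_ge0. Qed.

Lemma normr_normc x : `|x| = (normc x)%:C.
Proof. by case: x. Qed.

Lemma sqr_normc x : normc x ^+ 2 = Re x ^+ 2 + Im x ^+ 2.
Proof. by rewrite normc_sqrt sqr_sqrtr// addr_ge0// sqr_ge0. Qed.

Lemma le_Re_normc x : `|Re x| <= normc x.
Proof. by rewrite normc_sqrt -sqrtr_sqr ler_wsqrtr// lerDl sqr_ge0. Qed.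

Lemma le_Im_normc x : `|Im x| <= normc x.
Proof. by rewrite normc_sqrt -sqrtr_sqr ler_wsqrtr// lerDr sqr_ge0. Qed.

Lemma le_normc_ReIm x : normc x <= `|Re x| + `|Im x|.
Proof.
rewrite normc_sqrt -[leRHS]ger0_norm ?addr_ge0// -sqrtr_sqr ler_wsqrtr//.
by rewrite sqrrD !real_normK ?num_real// lerD2r lerDl mulrn_wge0// mulr_ge0.
Qed.

Lemma normc_real t : normc t%:C = `|t|.
Proof. by rewrite normc_sqrt /= expr0n addr0 sqrtr_sqr. Qed.

Lemma normc_opp x : normc (- x) = normc x.
Proof. by rewrite !normc_sqrt ReN ImN !sqrrN. Qed.

Lemma normcX x n : normc (x ^+ n) = normc x ^+ n.
Proof.
elim: n => [|n ih]; first by rewrite !expr0 Normc.normc1.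
by rewrite !exprS Normc.normcM ih.
Qed.

Lemma natcE n : n%:R = (n%:R : R)%:C :> R[i].
Proof. exact: (esym (rmorph_nat (real_complex R) n)). Qed.

Lemma cexpD x y : cexp (x + y) = cexp x * cexp y.
Proof.
apply: complex_ext; rewrite /cexp !ReImE /= expRD cosD sinD; ring.
Qed.

Lemma cexp0 : cexp 0 = 1 :> R[i].
Proof.
by apply: complex_ext; rewrite /cexp !ReImE /= expR0 cos0 sin0; ring.
Qed.

Lemma normc_cexp x : normc (cexp x) = expR (Re x).
Proof.
rewrite /cexp Normc.normcM normc_real ger0_norm ?expR_ge0//.
by rewrite normc_sqrt /= cos2Dsin2 sqrtr1 mulr1.
Qed.

Lemma cexp_real t : cexp t%:C = (expR t)%:C.
Proof.
by apply: complex_ext; rewrite /cexp !ReImE /= cos0 sin0; ring.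
Qed.

End complex_facts.

(** * Derivatives of complex functions of a real variable *)

Section complex_derivative.
Context {R : realType}.
Local Notation Re := (@complex.Re R).
Local Notation Im := (@complex.Im R).
Implicit Types (f g : R -> R[i]) (t : R) (d : R[i]).

(** Only real differentiability along real paths is used, so that real calculus applies
    to each component. *)
Definition is_cderive (f : R -> R[i]) (t : R) (d : R[i]) : Prop :=
  is_derive t 1 (fun u => Re (f u)) (Re d) /\
  is_derive t 1 (fun u => Im (f u)) (Im d).

Lemma is_cderive_eq {f t d} d' : is_cderive f t d -> d = d' -> is_cderive f t d'.
Proof. by move=> ? <-. Qed.

Lemma is_cderive_cst c t : is_cderive (fun _ => c) t 0.
Proof. by split; exact: is_derive_cst. Qed.

Lemma is_cderive_real (h : R -> R) (t d : R) :
  is_derive t 1 h d -> is_cderive (fun u => (h u)%:C) t d%:C.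
Proof. by move=> hd; split => //=; exact: is_derive_cst. Qed.

Lemma is_cderiveD f g t df dg : is_cderive f t df -> is_cderive g t dg ->
  is_cderive (fun u => f u + g u) t (df + dg).
Proof.
move=> [fr fi] [gr gi]; split.
- rewrite ReD; under eq_fun do rewrite ReD; exact: is_deriveD.
- rewrite ImD; under eq_fun do rewrite ImD; exact: is_deriveD.
Qed.

Lemma is_cderiveM f g t df dg : is_cderive f t df -> is_cderive g t dg ->
  is_cderive (fun u => f u * g u) t (df * g t + f t * dg).
Proof.
move=> [fr fi] [gr gi]; split.
- under eq_fun do rewrite ReM.
  have H := is_deriveB (is_deriveM fr gr) (is_deriveM fi gi).
  by apply: (is_derive_eq H); rewrite !ReImE /GRing.scale/=; ring.
- under eq_fun do rewrite ImM.
  have H := is_deriveD (is_deriveM fr gi) (is_deriveM fi gr).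
  by apply: (is_derive_eq H); rewrite !ReImE /GRing.scale/=; ring.
Qed.

Lemma is_cderiveN f t df : is_cderive f t df ->
  is_cderive (fun u => - f u) t (- df).
Proof.
move=> [fr fi]; split.
- rewrite ReN; under eq_fun do rewrite ReN; exact: is_deriveN.
- rewrite ImN; under eq_fun do rewrite ImN; exact: is_deriveN.
Qed.

Lemma is_cderiveZ c f t df : is_cderive f t df ->
  is_cderive (fun u => c * f u) t (c * df).
Proof.
move=> fd; have := is_cderiveM _ _ _ _ _ (is_cderive_cst c t) fd.
by rewrite mul0r add0r.
Qed.

Lemma is_cderive_cexp f t d : is_cderive f t d ->
  is_cderive (fun u => cexp (f u)) t (d * cexp (f t)).
Proof.
move=> [fr fi].
have E : is_derive t 1 (fun u => expR (Re (f u))) (Re d * expR (Re (f t))).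
  have H := is_derive1_comp (is_derive_expR (Re (f t))) fr.
  by apply: (is_derive_eq H); ring.
have C : is_derive t 1 (fun u => cos (Im (f u))) (- sin (Im (f t)) * Im d).
  by have H := is_derive1_comp (is_derive_cos (Im (f t))) fi.
have S : is_derive t 1 (fun u => sin (Im (f u))) (cos (Im (f t)) * Im d).
  by have H := is_derive1_comp (is_derive_sin (Im (f t))) fi.
split.
- have H := is_deriveM E C.
  under eq_fun do rewrite /cexp ReM /= mul0r subr0.
  by apply: (is_derive_eq H); rewrite /cexp !ReImE /GRing.scale/=; ring.
- have H := is_deriveM E S.
  under eq_fun do rewrite /cexp ImM /= mul0r addr0.
  by apply: (is_derive_eq H); rewrite /cexp !ReImE /GRing.scale/=; ring.
Qed.

End complex_derivative.

(** * Taylor remainder of the complex exponential *)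

Section taylor.
Context {R : realType}.
Local Notation Re := (@complex.Re R).
Local Notation Im := (@complex.Im R).
Local Notation normc := (@Normc.normc R).

Lemma le_derive_ge0 (g g' : R -> R) (t : R) : 0 <= t ->
  (forall u : R, is_derive u 1 g (g' u)) -> (forall u, 0 <= u -> 0 <= g' u) ->
  g 0 <= g t.
Proof.
rewrite le_eqVlt => /predU1P[<-//|t0] gd g0.
have cg : {within `[0, t], continuous g}.
  apply: continuous_subspaceT => u.
  by apply/differentiable_continuous/derivable1_diffP; have [] := gd u.
have [c /[!in_itv]/= /andP[c0 ct] E] := MVT t0 (fun u _ => gd u) cg.
by rewrite -subr_ge0 E mulr_ge0// ?g0 ?subr_ge0// ltW.
Qed.

Lemma is_derive_pow (n : nat) (u : R) :
  is_derive u 1 (fun v : R => v ^+ n.+1 / n.+1`!%:R) (u ^+ n / n`!%:R).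
Proof.
have X := is_deriveX n.+1 (is_derive_id u (1 : R)).
have H := is_deriveZ (n.+1`!%:R^-1 : R) X.
have -> : (fun v : R => v ^+ n.+1 / n.+1`!%:R) =
    (n.+1`!%:R^-1 : R) \*: ((fun x : R => x) ^+ n.+1).
  by apply/funext => v; rewrite !fctE mulrC.
apply: (is_derive_eq H).
rewrite /GRing.scale /= mulr1 factS natrM invfM.
by rewrite mulrA [_^-1 * _ * _]mulrAC mulVf ?pnatr_eq0// mul1r mulrC.
Qed.

Definition cexp_rem (w : R[i]) (n : nat) (t : R) : R[i] :=
  cexp (t%:C * w) - \sum_(k < n) (t ^+ k / k`!%:R)%:C * w ^+ k.

Lemma is_cderive_sum (I : Type) (r : seq I) (f : I -> R -> R[i]) t (d : I -> R[i]) :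
  (forall i, is_cderive (f i) t (d i)) ->
  is_cderive (fun u => \sum_(i <- r) f i u) t (\sum_(i <- r) d i).
Proof.
move=> fd; elim: r => [|i r ih].
  rewrite big_nil; under eq_fun do rewrite big_nil; exact: is_cderive_cst.
rewrite big_cons; under eq_fun do rewrite big_cons; exact: is_cderiveD.
Qed.

Lemma is_cderive_cexp_rem w n t :
  is_cderive (cexp_rem w n.+1) t (w * cexp_rem w n t).
Proof.
rewrite /cexp_rem mulrBr; apply: is_cderiveD.
  apply: is_cderive_cexp.
  have := is_cderiveZ w _ _ _ (is_cderive_real _ _ _ (is_derive_id t 1)).
  by rewrite mulr1; under eq_fun do rewrite mulrC.
apply: is_cderiveN.
under eq_fun do rewrite big_ord_recl expr0 fact0 divr1 mul1r expr0.
rewrite -[X in is_cderive _ _ X]add0r mulr_sumr.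
apply: is_cderiveD; first exact: is_cderive_cst.
apply: is_cderive_sum => i.
have := is_cderiveZ (w ^+ i.+1) _ _ _ (is_cderive_real _ _ _ (is_derive_pow i t)).
under eq_fun do rewrite mulrC.
by move=> /is_cderive_eq; apply; rewrite exprS; ring.
Qed.

(** Cauchy-Schwarz in the plane: the left-hand side is Re (conj p * q). *)
Lemma Re_conj_mul_le (p q : R[i]) : Re p * Re q + Im p * Im q <= normc p * normc q.
Proof.
have -> : normc p = normc (conjc p) by rewrite !normc_sqrt; case: p => a b /=; rewrite sqrrN.
rewrite -Normc.normcM; apply: le_trans (le_Re_normc _).
apply: le_trans (ler_norm _); rewrite ReM.
by case: p => a b /=; case: q => c d /=; rewrite mulNr opprK.
Qed.

(** The derivative of the (n+1)-st remainder is w times the n-th one, so the bound integrates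
    from n to n+1.  To keep the sharp constant for a complex-valued function, the remainder is
    projected on its own direction p at time t; this real projection equals |p|^2 at t. *)
Lemma cexp_rem_le w n t : Re w <= 0 -> 0 <= t ->
  normc (cexp_rem w n t) <= normc w ^+ n * (t ^+ n / n`!%:R).
Proof.
move=> w0; elim: n t => [|n ih] t t0.
  rewrite /cexp_rem big_ord0 subr0 normc_cexp !expr0 fact0 divr1 mul1r.
  by rewrite -expR0 ler_expR ReM /= mul0r subr0 mulr_ge0_le0.
set p := cexp_rem w n.+1 t.
pose h u := Re p * Re (cexp_rem w n.+1 u) + Im p * Im (cexp_rem w n.+1 u).
pose b u : R := normc p * normc w ^+ n.+1 * (u ^+ n.+1 / n.+1`!%:R).
have rem0 : cexp_rem w n.+1 0 = 0.
  rewrite /cexp_rem mul0r cexp0 big_ord_recl !expr0 fact0 divr1 mul1r.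
  rewrite big1 ?addr0 ?subrr// => i _.
  by rewrite expr0n /= mul0r mul0r.
have : b 0 - h 0 <= b t - h t.
  pose d u := w * cexp_rem w n u.
  apply: (@le_derive_ge0 (fun u => b u - h u) (fun u =>
    normc p * normc w ^+ n.+1 * (u ^+ n / n`!%:R) - (Re p * Re (d u) + Im p * Im (d u)))) => //.
    move=> u; have [dr di] := is_cderive_cexp_rem w n u.
    exact: (is_deriveB (is_deriveZ _ (is_derive_pow n u))
      (is_deriveD (is_deriveZ (Re p) dr) (is_deriveZ (Im p) di))).
  move=> u u0; rewrite subr_ge0 (le_trans (Re_conj_mul_le _ _))//.
  rewrite -mulrA ler_wpM2l ?normc_ge0// Normc.normcM exprS -mulrA.
  by rewrite ler_wpM2l ?normc_ge0// ih.
rewrite /b /h rem0 /= expr0n /= mul0r !mulr0 addr0 subrr subr_ge0 -!expr2 -sqr_normc.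
have [->|p0] := eqVneq (normc p) 0.
  by rewrite mulr_ge0// ?exprn_ge0 ?normc_ge0// divr_ge0// exprn_ge0.
by rewrite expr2 -mulrA ler_pM2l// lt0r p0 normc_ge0.
Qed.

End taylor.

(** * The principal logarithm on the right half-plane *)

Section logarithm.
Context {R : realType}.
Local Notation Re := (@complex.Re R).
Local Notation Im := (@complex.Im R).
Local Notation normc := (@Normc.normc R).
Implicit Types z : R[i].

(** On the right half-plane the two branches of the principal argument, given by the arc cosine
    according to the sign of the imaginary part, glue into one smooth formula, which can be
    differentiated across the real axis. *)
Lemma carg_atan z : 0 < Re z -> carg z = atan (Im z / Re z).
Proof.
move=> z0; set y := Im z / Re z.
have E : Re z / normc z = cos (atan y).
  rewrite cos_atan normc_sqrt.
  have -> : Re z ^+ 2 + Im z ^+ 2 = Re z ^+ 2 * (1 + y ^+ 2).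
    by rewrite /y; field; rewrite gt_eqF.
  rewrite sqrtrM ?sqr_ge0// sqrtr_sqr gtr0_norm// invfM mulrA divff ?mul1r//.
  by rewrite gt_eqF.
have lp := atan_ltpi2 y; have gp := atan_gtNpi2 y; have pi0 := pi_ge0 R.
rewrite /carg E; case: ifPn => i0.
  have y0 : 0 <= atan y by rewrite -(atan0 R) le_atan// divr_ge0// ltW.
  by rewrite cosK// in_itv/= y0/=; lra.
have y0 : atan y <= 0.
  rewrite -(atan0 R) le_atan// mulr_le0_ge0 ?invr_ge0 ?(ltW z0)//.
  by rewrite ltW// ltNge.
by rewrite -cosN cosK ?opprK// in_itv/=; lra.
Qed.

Lemma clog_right_half z : 0 < Re z ->
  clog z = (ln (Re z ^+ 2 + Im z ^+ 2) / 2) +i* atan (Im z / Re z).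
Proof.
move=> z0; rewrite /clog carg_atan//; congr (_ +i* _).
rewrite -sqr_normc expr2 lnM ?posrE; try by
  rewrite lt0r normc_ge0 andbT; apply: contraTneq z0 => /Normc.eq0_normc ->; rewrite ltxx.
by field.
Qed.

Lemma Re_inv z : Re z^-1 = Re z / (Re z ^+ 2 + Im z ^+ 2).
Proof. by case: z. Qed.

Lemma Im_inv z : Im z^-1 = - (Im z / (Re z ^+ 2 + Im z ^+ 2)).
Proof. by case: z. Qed.

Lemma is_cderive_clog (f : R -> R[i]) t d : is_cderive f t d -> 0 < Re (f t) ->
  is_cderive (fun u => clog (f u)) t (d / f t).
Proof.
move=> [fr fi] f0.
have nf0 : \forall u \near t, 0 < Re (f u).
  have : {for t, continuous (fun u => Re (f u))}.
    by apply/differentiable_continuous/derivable1_diffP; have [] := fr.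
  by move=> /cvgr_gt; apply.
have q0 : 0 < Re (f t) ^+ 2 + Im (f t) ^+ 2.
  by rewrite ltr_wpDr ?sqr_ge0// exprn_gt0.
split.
- pose q u := Re (f u) * Re (f u) + Im (f u) * Im (f u).
  have Q : is_derive t 1 q _ := is_deriveD (is_deriveM fr fr) (is_deriveM fi fi).
  have L : is_derive (q t) 1 (@ln R) (Re (f t) ^+ 2 + Im (f t) ^+ 2)^-1.
    by rewrite /q -!expr2; exact: is_derive1_ln.
  have H : is_derive t 1 (2^-1 \*: (@ln R \o q)) (Re (d / f t)).
    apply: (is_derive_eq (is_deriveZ (2^-1 : R) (is_derive1_comp L Q))).
    rewrite ReM Re_inv Im_inv /GRing.scale /=.
    by field; rewrite gt_eqF.
  apply: near_eq_is_derive H.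
    near=> u; rewrite clog_right_half; last by near: u.
    by rewrite !fctE /q /GRing.scale /= !expr2 [RHS]mulrC.
- have V := is_deriveV (lt0r_neq0 f0) fr.
  have Q := is_deriveM fi V.
  have {}Q : is_derive t 1 (fun u => Im (f u) / Re (f u)) _ := Q.
  have H : is_derive t 1 (@atan R \o (fun u => Im (f u) / Re (f u))) (Im (d / f t)).
    apply: (is_derive_eq (is_derive1_comp (is_derive1_atan _) Q)).
    rewrite ImM Re_inv Im_inv /GRing.scale /=.
    by field; rewrite !gt_eqF.
  apply: near_eq_is_derive H.
  by near=> u; rewrite clog_right_half//; near: u.
Unshelve. all: by end_near. Qed.

End logarithm.

(** * The fundamental theorem of calculus on the open half-line *)

Section half_line.
Context {R : realType}.
Local Notation mu := (@lebesgue_measure R).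
Local Notation D := (`]0, +oo[%classic : set R).
Implicit Types (f F : R -> R).

Let I (n : nat) : set R := `[n.+2%:R^-1, n.+2%:R].

Lemma continuous_half_line_measurable f : (forall x, 0 < x -> {for x, continuous f}) ->
  measurable_fun D f.
Proof.
move=> cf; apply: open_continuous_measurable_fun.
  exact: interval_open.
by move=> x; rewrite inE /= in_itv /= andbT => /cf.
Qed.

Lemma integral_compact_FTC f F n : (forall x, 0 < x -> {for x, continuous f}) ->
  (forall x : R, 0 < x -> is_derive x 1 F (f x)) ->
  (\int[mu]_(x in I n) (f x)%:E = (F n.+2%:R - F n.+2%:R^-1)%:E)%E.
Proof.
move=> cf dF.
have n0 : 0 < (n.+2%:R^-1 : R) by rewrite invr_gt0 ltr0n.
have lt : (n.+2%:R^-1 : R) < n.+2%:R.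
  rewrite (@lt_trans _ _ 1)// ?ltr1n// invf_lt1 ?ltr0n// ltr1n//.
have cF x : 0 < x -> {for x, continuous F}.
  by move=> /dF [? _]; apply/differentiable_continuous/derivable1_diffP.
rewrite EFinB; apply: continuous_FTC2 => //.
- apply: continuous_in_subspaceT => x; rewrite inE /= in_itv/= => /andP[x0 _].
  by apply: cf; exact: lt_le_trans x0.
- split.
  + by move=> x; rewrite in_itv/= => /andP[x0 _]; have [] := dF x (lt_trans n0 x0).
  + by apply: cvg_at_right_filter; exact: cF.
  + by apply: cvg_at_left_filter; apply: cF; exact: lt_trans lt.
- move=> x; rewrite in_itv/= => /andP[x0 _]; have [_ <-] := dF x (lt_trans n0 x0).
  by rewrite derive1E.
Qed.

Lemma bigcup_segment : \bigcup_n I n = D.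
Proof.
apply/seteqP; split => [x [n _]|x]; rewrite /= ?/I /= !in_itv /= andbT.
  by move=> /andP[n0 _]; rewrite (lt_le_trans _ n0)// invr_gt0 ltr0n.
move=> x0.
have [n Hn] : exists n : nat, Num.max x x^-1 < n%:R.
  by exists (Num.truncn (Num.max x x^-1)).+1; exact: truncnS_gt.
exists n => //; rewrite /I /= in_itv/=.
move: Hn; rewrite gt_max => /andP[h1 h2].
have h3 : n%:R <= n.+2%:R :> R by rewrite ler_nat leqW.
rewrite (ltW (lt_le_trans h1 h3)) andbT -[leRHS]invrK lef_pV2 ?posrE ?invr_gt0 ?ltr0n//.
exact: ltW (lt_le_trans h2 h3).
Qed.

Lemma segment_nondecreasing : nondecreasing_seq I.
Proof.
move=> m n mn; apply/subsetPset => x; rewrite /I /= !in_itv/= => /andP[h1 h2].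
rewrite (le_trans _ h1) ?(le_trans h2) ?ler_nat// lef_pV2 ?posrE ?ltr0n// ler_nat.
by rewrite ltnS ltnS.
Qed.

Lemma measurable_segment n : measurable (I n). Proof. exact: measurable_itv. Qed.

Lemma segment_half_line n : I n `<=` D.
Proof. by rewrite -bigcup_segment; exact: bigcup_sup. Qed.

(** By monotone convergence along the segments [1/(n+2), n+2], on which the integral is a
    difference of two values of F.  It gives integrability near both ends of the half-line at
    once, including the singularity of t^{sigma-1} at 0. *)
Lemma integrable_bounded_antiderivative f F (M : R) :
  (forall x, 0 < x -> {for x, continuous f}) ->
  (forall x, 0 < x -> 0 <= f x) ->
  (forall x : R, 0 < x -> is_derive x 1 F (f x)) ->
  (forall x, 0 < x -> `|F x| <= M) ->
  mu.-integrable D (EFin \o f).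
Proof.
move=> cf f0 dF FM; have mf := continuous_half_line_measurable _ cf.
apply/integrableP; split; first exact/measurable_EFinP.
under eq_integral => x.
  rewrite inE /= in_itv /= andbT => x0; rewrite ger0_norm ?f0//.
  over.
have mfI n : measurable_fun (I n) (EFin \o f).
  by apply: (@measurable_funS _ _ _ _ D) => //; [exact: segment_half_line|exact/measurable_EFinP].
have fI0 n x : I n x -> (0 <= (EFin \o f) x)%E.
  by move=> /segment_half_line /=; rewrite in_itv/= andbT lee_fin; exact: f0.
have cvgI : (\int[mu]_(x in I n) (f x)%:E)%E @[n --> \oo] -->
    (\int[mu]_(x in D) (f x)%:E)%E.
  rewrite -bigcup_segment.
  exact: (@ge0_nondecreasing_set_cvg_integral _ (measurableTypeR R) R I (EFin \o f) mu
    segment_nondecreasing measurable_segment mfI fI0).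
apply: (@le_lt_trans _ _ (2 * M)%:E); last exact: ltry.
rewrite -(cvg_lim _ cvgI)//; apply: lime_le; first by apply: cvgP cvgI.
apply: nearW => n; rewrite (integral_compact_FTC _ _ _ cf dF) lee_fin.
have n0 : 0 < (n.+2%:R^-1 : R) by rewrite invr_gt0 ltr0n.
have h1 := FM _ n0; have h2 := FM n.+2%:R (ltr0Sn _ _).
rewrite (le_trans (ler_norm _))// (le_trans (ler_normB _ _))//.
by rewrite mulr_natl mulr2n lerD.
Qed.

(** Integrability is assumed here because f may change sign; dominated convergence along the
    same segments then replaces monotone convergence. *)
Lemma integral_half_line_FTC f F :
  (forall x, 0 < x -> {for x, continuous f}) ->
  (forall x : R, 0 < x -> is_derive x 1 F (f x)) ->
  mu.-integrable D (EFin \o f) ->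
  F n.+2%:R @[n --> \oo] --> (0 : R) -> F n.+2%:R^-1 @[n --> \oo] --> (0 : R) ->
  \int[mu]_(x in D) f x = 0.
Proof.
move=> cf dF intf F1 F2; have mf := continuous_half_line_measurable _ cf.
have mfI n : measurable_fun D (((EFin \o f)) \_ (I n)).
  apply/measurable_restrict => //; first exact: measurable_segment.
  by apply: (@measurable_funS _ _ _ _ D) => //; exact/measurable_EFinP.
have [] := @dominated_convergence _ _ _ mu D (measurable_itv _)
   (fun n => (EFin \o f) \_ (I n)) (EFin \o f) (abse \o (EFin \o f)) mfI.
- exact/measurable_EFinP.
- apply: aeW => x Dx; apply: cvg_near_cst.
  move: (Dx); rewrite -{1}bigcup_segment => -[n _ Inx]; exists n => // m /= nm.
  by rewrite patchE mem_set//; move/subsetPset: (segment_nondecreasing _ _ nm); exact.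
- exact: integrable_abse.
- by apply: aeW => x n Dx; rewrite patchE; case: ifPn => //= _; rewrite normr0 lee_fin.
move=> _ _ cv.
have {}cv : (F n.+2%:R - F n.+2%:R^-1)%:E @[n --> \oo] --> (\int[mu]_(x in D) (f x)%:E)%E.
  apply: cvg_trans cv; apply: near_eq_cvg; apply: nearW => n /=.
  rewrite -integral_mkcondr ((setIidPr _ _).2 (segment_half_line n)).
  by rewrite (integral_compact_FTC _ _ _ cf dF).
have cv0 : (F n.+2%:R - F n.+2%:R^-1)%:E @[n --> \oo] --> (0 : R)%:E.
  by apply: cvg_EFin; [exact: nearW | rewrite -(subrr 0); exact: cvgB].
by rewrite /Rintegral (cvg_unique _ cv cv0).
Qed.

End half_line.

(** * Integration of complex functions *)

Section complex_integration.
Context d (T : measurableType d) {R : realType} (mu : {measure set T -> \bar R}).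
Variables (D : set T) (mD : measurable D).
Local Notation Re := (@complex.Re R).
Local Notation Im := (@complex.Im R).
Local Notation normc := (@Normc.normc R).
Implicit Types (f g : T -> R[i]).

Definition cmeasurable f : Prop :=
  measurable_fun D (fun x => Re (f x)) /\ measurable_fun D (fun x => Im (f x)).

Lemma cmeasurable_cst c : cmeasurable (fun _ => c).
Proof. by split. Qed.

Lemma cmeasurable_real (h : T -> R) : measurable_fun D h -> cmeasurable (fun x => (h x)%:C).
Proof. by split. Qed.

Lemma cmeasurableD f g : cmeasurable f -> cmeasurable g -> cmeasurable (fun x => f x + g x).
Proof.
move=> [fr fi] [gr gi]; split.
- by under eq_fun do rewrite ReD; exact: measurable_funD.
- by under eq_fun do rewrite ImD; exact: measurable_funD.
Qed.

Lemma cmeasurableM f g : cmeasurable f -> cmeasurable g -> cmeasurable (fun x => f x * g x).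
Proof.
move=> [fr fi] [gr gi]; split.
- by under eq_fun do rewrite ReM; apply: measurable_funB; exact: measurable_funM.
- by under eq_fun do rewrite ImM; apply: measurable_funD; exact: measurable_funM.
Qed.

Lemma cmeasurableX f n : cmeasurable f -> cmeasurable (fun x => f x ^+ n).
Proof.
move=> mf; elim: n => [|n ih].
  by under eq_fun do rewrite expr0; exact: cmeasurable_cst.
by under eq_fun do rewrite exprS; exact: cmeasurableM.
Qed.

Lemma cmeasurable_cexp f : cmeasurable f -> cmeasurable (fun x => cexp (f x)).
Proof.
move=> [fr fi]; apply: cmeasurableM.
  by apply: cmeasurable_real; exact: measurableT_comp.
split => /=.
- apply: (measurableT_comp _ fi).
  by apply: continuous_measurable_fun; exact: continuous_cos.
- apply: (measurableT_comp _ fi).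
  by apply: continuous_measurable_fun; exact: continuous_sin.
Qed.

Lemma le_cintegrable f (h : T -> R) : cmeasurable f ->
  mu.-integrable D (EFin \o h) -> (forall x, D x -> normc (f x) <= h x) ->
  cintegrable mu D f.
Proof.
move=> [fr fi] ih fh; split.
- apply: le_integrable ih => //; first exact/measurable_EFinP.
  move=> x Dx /=; rewrite lee_fin (le_trans (le_Re_normc _))//.
  by rewrite (le_trans (fh _ Dx))// ler_norm.
- apply: le_integrable ih => //; first exact/measurable_EFinP.
  move=> x Dx /=; rewrite lee_fin (le_trans (le_Im_normc _))//.
  by rewrite (le_trans (fh _ Dx))// ler_norm.
Qed.

Lemma eq_cintegral g f : {in D, f =1 g} -> cintegral mu D f = cintegral mu D g.
Proof.
move=> fg; congr (_ +i* _); apply: eq_Rintegral => x Dx; by rewrite fg.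
Qed.

Lemma eq_cintegrable g f : {in D, f =1 g} -> cintegrable mu D f -> cintegrable mu D g.
Proof.
move=> fg [fr fi]; split; [apply: eq_integrable fr => // | apply: eq_integrable fi => //];
  by move=> x Dx /=; rewrite fg.
Qed.

Lemma cintegrableD f g : cintegrable mu D f -> cintegrable mu D g ->
  cintegrable mu D (fun x => f x + g x).
Proof.
move=> [fr fi] [gr gi]; split.
- by apply: eq_integrable (integrableD mD fr gr) => // x _ /=; rewrite ReD.
- by apply: eq_integrable (integrableD mD fi gi) => // x _ /=; rewrite ImD.
Qed.

Lemma cintegralD f g : cintegrable mu D f -> cintegrable mu D g ->
  cintegral mu D (fun x => f x + g x) = cintegral mu D f + cintegral mu D g.
Proof.
move=> [fr fi] [gr gi]; rewrite /cintegral; apply: complex_ext => /=.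
- by under eq_Rintegral do rewrite ReD; exact: RintegralD.
- by under eq_Rintegral do rewrite ImD; exact: RintegralD.
Qed.

Lemma integrable_lincomb (a b : R) (f1 f2 : T -> R) :
  mu.-integrable D (EFin \o f1) -> mu.-integrable D (EFin \o f2) ->
  mu.-integrable D (EFin \o (fun x => a * f1 x + b * f2 x)).
Proof.
move=> i1 i2.
exact: eq_integrable (integrableD mD (integrableZl mD a i1) (integrableZl mD b i2)).
Qed.

Lemma Rintegral_lincomb (a b : R) (f1 f2 : T -> R) :
  mu.-integrable D (EFin \o f1) -> mu.-integrable D (EFin \o f2) ->
  Rintegral mu D (fun x => a * f1 x + b * f2 x) =
  a * Rintegral mu D f1 + b * Rintegral mu D f2.
Proof.
move=> i1 i2; rewrite RintegralD// ?RintegralZl//.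
- exact: (integrableZl mD a i1).
- exact: (integrableZl mD b i2).
Qed.

Lemma cintegrableZ c f : cintegrable mu D f -> cintegrable mu D (fun x => c * f x).
Proof.
move=> [fr fi]; split.
- apply: eq_integrable (integrable_lincomb (Re c) (- Im c) _ _ fr fi) => // x _ /=.
  by rewrite ReM mulNr.
- apply: eq_integrable (integrable_lincomb (Re c) (Im c) _ _ fi fr) => // x _ /=.
  by rewrite ImM.
Qed.

Lemma cintegralZ c f : cintegrable mu D f ->
  cintegral mu D (fun x => c * f x) = c * cintegral mu D f.
Proof.
move=> [fr fi]; apply: complex_ext; rewrite ?ReM ?ImM /=.
- by under eq_Rintegral do rewrite ReM -mulNr; rewrite Rintegral_lincomb// mulNr.
- by under eq_Rintegral do rewrite ImM; rewrite Rintegral_lincomb.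
Qed.

Lemma cintegral_sum I (r : seq I) (f : I -> T -> R[i]) :
  (forall i, cintegrable mu D (f i)) ->
  cintegrable mu D (fun x => \sum_(i <- r) f i x) /\
  cintegral mu D (fun x => \sum_(i <- r) f i x) = \sum_(i <- r) cintegral mu D (f i).
Proof.
move=> fi; elim: r => [|i r [ih1 ih2]].
  rewrite big_nil; under eq_fun do rewrite big_nil; split.
    by split; exact: integrable0.
  by apply: complex_ext; rewrite /= /Rintegral integral0.
rewrite big_cons; under eq_fun do rewrite big_cons; split; first exact: cintegrableD.
by rewrite cintegralD// ih2.
Qed.

(** The factor 2 comes from bounding the two components separately; it is
    absorbed by the limits and by the asymptotic constants. *)
Lemma normc_cintegral_le f (h : T -> R) : cintegrable mu D f ->
  mu.-integrable D (EFin \o h) -> (forall x, D x -> normc (f x) <= h x) ->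
  normc (cintegral mu D f) <= 2 * Rintegral mu D h.
Proof.
move=> [fr fi] ih fh; rewrite (le_trans (le_normc_ReIm _))//=.
rewrite mulr_natl mulr2n; apply: lerD.
- rewrite (le_trans (le_normr_Rintegral _ _))//.
  apply: le_Rintegral => //; first exact: integrable_norm.
  by move=> x Dx; rewrite (le_trans (le_Re_normc _))// fh.
- rewrite (le_trans (le_normr_Rintegral _ _))//.
  apply: le_Rintegral => //; first exact: integrable_norm.
  by move=> x Dx; rewrite (le_trans (le_Im_normc _))// fh.
Qed.

End complex_integration.

Arguments cmeasurable {d T R} D f.

(** * The gamma density and the Mellin kernel *)

Section mellin_kernel.
Context {R : realType}.
Local Notation mu := (@lebesgue_measure R).
Local Notation D := (`]0, +oo[%classic : set R).
Local Notation Re := (@complex.Re R).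
Local Notation Im := (@complex.Im R).
Local Notation normc := (@Normc.normc R).
Implicit Types (s z : R[i]) (t b sigma : R).

(** This is t^{sigma-1} e^{-bt} for t > 0, written as a single exponential so that it is literally
    the modulus of the Mellin kernel. *)
Definition gamma_density sigma b t : R := expR ((sigma - 1) * ln t - b * t).

(** The logarithm is sublinear: half of the decay of e^{-bt} absorbs the factor t^sigma. *)
Lemma ln_linear_le sigma b t : 0 < sigma -> 0 < b -> 0 < t ->
  sigma * ln t - b * t <= sigma * ln (2 * sigma / b) - b / 2 * t.
Proof.
move=> s0 b0 t0.
have p0 : 0 < b * t / (2 * sigma) by rewrite divr_gt0 ?mulr_gt0.
have q0 : 0 < 2 * sigma / b by rewrite divr_gt0 ?mulr_gt0.
have E : ln t = ln (b * t / (2 * sigma)) + ln (2 * sigma / b).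
  rewrite -lnM ?posrE//; congr ln; field.
  by rewrite !gt_eqF.
have := ltW (ln_sublinear p0).
rewrite -(ler_pM2l s0) => H; rewrite E mulrDr.
have : sigma * (b * t / (2 * sigma)) = b / 2 * t by field; rewrite gt_eqF.
by move: H => /[swap] ->; lra.
Qed.

Lemma measurable_gamma_density sigma b : measurable_fun setT (gamma_density sigma b).
Proof.
apply: measurableT_comp => //; apply: measurable_funB.
  by apply: measurable_funM => //; exact: measurable_ln.
exact: measurable_funM.
Qed.

Lemma gamma_density_shift sigma b t : 0 < t ->
  gamma_density (sigma + 1) b t = t * gamma_density sigma b t.
Proof.
move=> t0; rewrite -[X in X * _]lnK ?posrE// -expRD; congr expR; ring.
Qed.

Lemma is_derive_gamma_density sigma b t : 0 < t ->
  is_derive t 1 (gamma_density (sigma + 1) b)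
    (sigma * gamma_density sigma b t - b * gamma_density (sigma + 1) b t).
Proof.
move=> t0; pose h (u : R) := (sigma + 1 - 1) * ln u - b * u.
have dh : is_derive t 1 h ((sigma + 1 - 1) * t^-1 - b * 1).
  exact: (is_deriveB (is_deriveZ (sigma + 1 - 1) (is_derive1_ln t0))
                     (is_deriveZ b (is_derive_id t (1 : R)))).
apply: (is_derive_eq (is_derive1_comp (is_derive_expR (h t)) dh)).
rewrite -[expR (h t)]/(gamma_density (sigma + 1) b t) gamma_density_shift//.
by field; rewrite gt_eqF.
Qed.

Lemma continuous_gamma_density sigma b t : 0 < t ->
  {for t, continuous (gamma_density sigma b)}.
Proof.
move=> t0; have := is_derive_gamma_density (sigma - 1) b _ t0; rewrite subrK => -[+ _].
by move=> ?; apply/differentiable_continuous/derivable1_diffP.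
Qed.

Lemma gamma_density_le sigma b t : 0 < sigma -> 0 < b -> 0 < t ->
  gamma_density (sigma + 1) b t <=
    expR (sigma * ln (2 * sigma / b)) * gamma_density 1 (b / 2) t.
Proof.
move=> s0 b0 t0; rewrite /gamma_density -expRD ler_expR subrr mul0r add0r addrK.
exact: ln_linear_le.
Qed.

Lemma gamma_density1_le1 b t : 0 < b -> 0 < t -> gamma_density 1 b t <= 1.
Proof.
move=> b0 t0; rewrite /gamma_density -expR0 ler_expR subrr mul0r add0r oppr_le0 mulr_ge0 ?ltW//.
Qed.

(** With C as in [gamma_density_le], F(t) = t^sigma e^{-bt} - 2 C e^{-bt/2} is bounded, and the
    second term makes its derivative f at least sigma t^{sigma-1} e^{-bt}.  Thus f is
    nonnegative with a bounded antiderivative, and it dominates the density. *)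
Lemma integrable_gamma_density sigma b : 0 < sigma -> 0 < b ->
  mu.-integrable D (EFin \o gamma_density sigma b).
Proof.
move=> s0 b0; pose C := expR (sigma * ln (2 * sigma / b)).
have C0 : 0 < C by exact: expR_gt0.
have b20 : 0 < b / 2 by rewrite divr_gt0.
pose F t : R := gamma_density (sigma + 1) b t - (2 * C) * gamma_density 1 (b / 2) t.
pose f t : R := sigma * gamma_density sigma b t - b * gamma_density (sigma + 1) b t
  + (b * C) * gamma_density 1 (b / 2) t.
have fge t : 0 < t -> sigma * gamma_density sigma b t <= f t.
  move=> t0; rewrite /f -addrA lerDl addrC subr_ge0 -mulrA ler_pM2l//.
  exact: gamma_density_le.
have gd0 u v w : 0 <= gamma_density u v w by exact: expR_ge0.
have intf : mu.-integrable D (EFin \o f).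
  apply: (integrable_bounded_antiderivative _ F (3 * C)).
  - move=> t t0; apply: cvgD; first apply: cvgB.
    + by apply: cvgM; [exact: cvg_cst|exact: continuous_gamma_density].
    + by apply: cvgM; [exact: cvg_cst|exact: continuous_gamma_density].
    + by apply: cvgM; [exact: cvg_cst|exact: continuous_gamma_density].
  - by move=> t t0; rewrite (le_trans _ (fge _ t0))// mulr_ge0 ?(ltW s0).
  - move=> t t0.
    have d1 := is_derive_gamma_density 0 (b / 2) _ t0; rewrite add0r in d1.
    apply: (is_derive_eq (is_deriveB (is_derive_gamma_density sigma b _ t0)
      (is_deriveZ (2 * C) d1))).
    by rewrite /f /GRing.scale /= ; field.
  - move=> t t0; rewrite (le_trans (ler_normB _ _))//.
    have h1 := gamma_density_le _ _ _ s0 b0 t0.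
    have h2 := gamma_density1_le1 _ _ b20 t0.
    rewrite ger0_norm// ger0_norm ?mulr_ge0 ?(ltW C0)//.
    rewrite -/C in h1; have : C * gamma_density 1 (b / 2) t <= C by rewrite ler_piMr// ltW.
    by lra.
apply: le_integrable (integrableZl _ sigma^-1 intf) => //.
- by apply/measurable_EFinP/measurable_funTS; exact: measurable_gamma_density.
- move=> t /=; rewrite in_itv/= andbT => t0; rewrite lee_fin !ger0_norm//.
    by rewrite ler_pdivlMl// fge.
  by rewrite mulr_ge0 ?invr_ge0 ?(ltW s0)// (le_trans _ (fge _ t0))// mulr_ge0 ?(ltW s0).
Qed.

Lemma expRN_cvg0 (u : R^nat) : u n @[n --> \oo] --> +oo ->
  expR (- u n) @[n --> \oo] --> (0 : R).
Proof. by move=> uy; exact: (cvg_comp _ _ uy (@cvgr_expR R)). Qed.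

Lemma natSS_cvgy b : 0 < b -> b * n.+2%:R @[n --> \oo] --> +oo.
Proof.
move=> b0; apply/cvgryPge => A; near=> n.
rewrite -ler_pdivrMl//; near: n.
exists (Num.truncn (b^-1 * A)) => // n /= h.
apply: ltW; apply: lt_le_trans (truncnS_gt _) _.
by rewrite ler_nat ltnS leqW.
Unshelve. all: by end_near. Qed.

Lemma gamma_density_cvgy sigma b : 0 < sigma -> 0 < b ->
  gamma_density (sigma + 1) b n.+2%:R @[n --> \oo] --> (0 : R).
Proof.
move=> s0 b0; have b20 : 0 < b / 2 by rewrite divr_gt0.
apply: (@squeeze_cvgr _ _ _ _ (cst 0)
  (fun n => expR (sigma * ln (2 * sigma / b)) * expR (- (b / 2 * n.+2%:R)))).
- apply: nearW => n; rewrite expR_ge0 /=.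
  have := gamma_density_le _ _ _ s0 b0 (ltr0Sn R n.+1).
  by rewrite {2}/gamma_density subrr mul0r add0r.
- exact: cvg_cst.
- rewrite -(mulr0 (expR (sigma * ln (2 * sigma / b)))); apply: cvgM; first exact: cvg_cst.
  by apply: expRN_cvg0; exact: natSS_cvgy.
Qed.

Lemma gamma_density_cvg0 sigma b : 0 < sigma -> 0 < b ->
  gamma_density (sigma + 1) b n.+2%:R^-1 @[n --> \oo] --> (0 : R).
Proof.
move=> s0 b0.
apply: (@squeeze_cvgr _ _ _ _ (cst 0) (fun n => expR (- (sigma * ln n.+2%:R)))).
- apply: nearW => n; rewrite expR_ge0 /= /gamma_density ler_expR addrK lnV ?posrE ?ltr0n//.
  by rewrite mulrN lerBlDr lerDl mulr_ge0 ?ltW// invr_gt0 ltr0n.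
- exact: cvg_cst.
- apply: expRN_cvg0; apply/cvgryPge => A; near=> n.
  rewrite -ler_pdivrMl// -[leLHS]expRK ler_ln ?posrE ?expR_gt0 ?ltr0n//.
  near: n; have /cvgryPge /(_ (expR (sigma^-1 * A))) := natSS_cvgy 1 ltr01.
  by apply: filterS => n; rewrite mul1r.
Unshelve. all: by end_near. Qed.

(** This is t^{s-1} e^{-tz} for t > 0. *)
Definition mellin_kernel s z t : R[i] := cexp ((s - 1) * (ln t)%:C - t%:C * z).

Definition mellin s z : R[i] := cintegral mu D (mellin_kernel s z).

Lemma normc_mellin_kernel s z t :
  normc (mellin_kernel s z t) = gamma_density (Re s) (Re z) t.
Proof.
rewrite normc_cexp /gamma_density !ReImE /=; congr expR; ring.
Qed.

Lemma mellin_kernel_shift s z t : 0 < t ->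
  mellin_kernel (s + 1) z t = t%:C * mellin_kernel s z t.
Proof.
move=> t0; rewrite -[X in X%:C * _]lnK ?posrE// -cexp_real -cexpD; congr cexp; ring.
Qed.

Lemma is_cderive_mellin_kernel s z t : 0 < t ->
  is_cderive (mellin_kernel (s + 1) z) t
    (s * mellin_kernel s z t - z * mellin_kernel (s + 1) z t).
Proof.
move=> t0.
have dl := is_cderive_real _ _ _ (is_derive1_ln t0).
have di := is_cderive_real _ _ _ (is_derive_id t (1 : R)).
have H := is_cderive_cexp _ _ _ (is_cderiveD _ _ _ _ _ (is_cderiveZ (s + 1 - 1) _ _ _ dl)
  (is_cderiveN _ _ _ (is_cderiveZ z _ _ _ di))).
have -> : mellin_kernel (s + 1) z =
    (fun u : R => cexp ((s + 1 - 1) * (ln u)%:C - z * u%:C)).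
  by apply/funext => u; rewrite /mellin_kernel [z * _]mulrC.
apply: (is_cderive_eq _ H).
rewrite [z * t%:C]mulrC -/(mellin_kernel (s + 1) z t) mellin_kernel_shift//.
have -> : (t^-1)%:C = (t%:C)^-1 :> R[i] by rewrite fmorphV.
have : t%:C != 0 :> R[i] by rewrite -[0]/(0%:C) (inj_eq (@complexI R)) gt_eqF.
by move=> ?; field.
Qed.

Lemma cmeasurable_mellin_kernel s z : cmeasurable setT (mellin_kernel s z).
Proof.
apply: cmeasurable_cexp; apply: cmeasurableD.
  apply: cmeasurableM; first exact: cmeasurable_cst.
  by apply: cmeasurable_real; exact: measurable_ln.
under eq_fun do rewrite -mulrN.
by apply: cmeasurableM; [exact: cmeasurable_real|exact: cmeasurable_cst].
Qed.

Lemma cintegrable_mellin_kernel s z : 0 < Re s -> 0 < Re z ->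
  cintegrable mu D (mellin_kernel s z).
Proof.
move=> s0 z0; apply: (@le_cintegrable _ _ _ mu D _ _ (gamma_density (Re s) (Re z))) => //.
- by have [? ?] := cmeasurable_mellin_kernel s z; split; exact: measurable_funTS.
- exact: integrable_gamma_density.
- by move=> t _; rewrite normc_mellin_kernel.
Qed.

End mellin_kernel.

(** * The integral of t^(s-1) exp(-tz) *)

(** The partial derivative f' is a separate function, so that the real or the imaginary part of a
    complex derivative can be supplied for it. *)
Lemma is_derive_under_integral d (T : measurableType d) (R : realType)
    (mu : {measure set T -> \bar R}) (B : set T) (f f' : R -> T -> R) (G : T -> R)
    (x u v : R) : measurable B -> x \in `]u, v[ ->
  (forall r, r \in `]u, v[ -> mu.-integrable B (EFin \o f r)) ->
  (forall r y, r \in `]u, v[ -> B y -> is_derive r 1 (f ^~ y) (f' r y)) ->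
  (forall y, 0 <= G y) -> mu.-integrable B (EFin \o G) ->
  (forall r y, r \in `]u, v[ -> B y -> `|f' r y| <= G y) ->
  is_derive x 1 (fun r => Rintegral mu B (f r)) (Rintegral mu B (f' x)).
Proof.
move=> mB xI intf df G0 intG Gub.
have E r y : r \in `]u, v[ -> B y -> partial1of2 f r y = f' r y.
  by move=> rI By; rewrite partial1of2E; have [_ ->] := df _ _ rI By.
have df1 r y : `]u, v[%classic r -> B y -> derivable (f ^~ y) r 1.
  by move=> rI By; have [] := df _ _ rI By.
have Gub1 r y : `]u, v[%classic r -> B y -> `|partial1of2 f r y| <= G y.
  by move=> rI By; rewrite E//; exact: Gub.
apply: DeriveDef.
  exact: (derivable_under_integral mB xI intf df1 G0 intG Gub1).
rewrite -derive1E (differentiation_under_integral mB xI intf df1 G0 intG Gub1).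
by apply: eq_Rintegral => y /set_mem By; exact: E.
Qed.

Section mellin_transform.
Context {R : realType}.
Local Notation mu := (@lebesgue_measure R).
Local Notation D := (`]0, +oo[%classic : set R).
Local Notation Re := (@complex.Re R).
Local Notation Im := (@complex.Im R).
Local Notation normc := (@Normc.normc R).
Implicit Types (s z : R[i]) (t b sigma : R).

(** The derivative of t^s e^{-tz} is s t^{s-1} e^{-tz} - z t^s e^{-tz}, and t^s e^{-tz} vanishes
    at both ends of the half-line. *)
Lemma mellinS s z : 0 < Re s -> 0 < Re z -> s * mellin s z = z * mellin (s + 1) z.
Proof.
move=> s0 z0; have s10 : 0 < Re (s + 1) by rewrite ReD /= addr_gt0.
have i1 := cintegrable_mellin_kernel _ _ s0 z0.
have i2 := cintegrable_mellin_kernel _ _ s10 z0.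
pose g t := s * mellin_kernel s z t + (- z) * mellin_kernel (s + 1) z t.
have ig1 : cintegrable mu D (fun t => s * mellin_kernel s z t) by exact: cintegrableZ.
have ig2 : cintegrable mu D (fun t => - z * mellin_kernel (s + 1) z t).
  exact: cintegrableZ.
have [igr igi] : cintegrable mu D g by exact: cintegrableD.
have dG t : 0 < t -> is_cderive (mellin_kernel (s + 1) z) t (g t).
  move=> t0; apply: (is_cderive_eq _ (is_cderive_mellin_kernel _ _ _ t0)).
  by rewrite /g mulNr.
have kc s' t : 0 < t -> {for t, continuous (fun t => Re (mellin_kernel s' z t))} /\
    {for t, continuous (fun t => Im (mellin_kernel s' z t))}.
  move=> t0; have := is_cderive_mellin_kernel (s' - 1) z _ t0.
  rewrite subrK => -[[? _] [? _]].
  by split; apply/differentiable_continuous/derivable1_diffP.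
have bound t : `|Re (mellin_kernel (s + 1) z t)| <= gamma_density (Re s + 1) (Re z) t /\
    `|Im (mellin_kernel (s + 1) z t)| <= gamma_density (Re s + 1) (Re z) t.
  rewrite (_ : Re s + 1 = Re (s + 1)); last by rewrite ReD.
  by rewrite -normc_mellin_kernel le_Re_normc le_Im_normc.
have lim0 (h : R -> R) (u : R^nat) :
    (forall t, `|h t| <= gamma_density (Re s + 1) (Re z) t) ->
    gamma_density (Re s + 1) (Re z) (u n) @[n --> \oo] --> (0 : R) ->
    h (u n) @[n --> \oo] --> (0 : R).
  move=> hle gc; apply: norm_cvg0; apply: (@squeeze_cvgr _ _ _ _ (cst 0) _ _ _ _ _ gc).
    by apply: nearW => n; rewrite normr_ge0 hle.
  exact: cvg_cst.
have cy := gamma_density_cvgy _ _ s0 z0; have c0 := gamma_density_cvg0 _ _ s0 z0.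
suff : cintegral mu D g = 0.
  rewrite cintegralD// !cintegralZ// mulNr => /eqP.
  by rewrite subr_eq0 => /eqP.
apply: complex_ext => /=.
- apply: (integral_half_line_FTC _ (fun t => Re (mellin_kernel (s + 1) z t))) => //.
  + move=> t t0; have [c1 c2] := kc s _ t0; have [c3 c4] := kc (s + 1) _ t0.
    have -> : (fun x => Re (g x)) = (fun x =>
        Re s * Re (mellin_kernel s z x) - Im s * Im (mellin_kernel s z x) +
        (Re (- z) * Re (mellin_kernel (s + 1) z x) -
         Im (- z) * Im (mellin_kernel (s + 1) z x))).
      by apply/funext => x; rewrite /g ReD !ReM.
    by apply: cvgD; apply: cvgB; apply: cvgM => //; exact: cvg_cst.
  + by move=> t t0; have [] := dG _ t0.
  + exact: (lim0 (fun t => Re (mellin_kernel (s + 1) z t)) _ (fun t => (bound t).1) cy).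
  + exact: (lim0 (fun t => Re (mellin_kernel (s + 1) z t)) _ (fun t => (bound t).1) c0).
- apply: (integral_half_line_FTC _ (fun t => Im (mellin_kernel (s + 1) z t))) => //.
  + move=> t t0; have [c1 c2] := kc s _ t0; have [c3 c4] := kc (s + 1) _ t0.
    have -> : (fun x => Im (g x)) = (fun x =>
        Re s * Im (mellin_kernel s z x) + Im s * Re (mellin_kernel s z x) +
        (Re (- z) * Im (mellin_kernel (s + 1) z x) +
         Im (- z) * Re (mellin_kernel (s + 1) z x))).
      by apply/funext => x; rewrite /g ImD !ImM.
    by apply: cvgD; apply: cvgD; apply: cvgM => //; exact: cvg_cst.
  + by move=> t t0; have [] := dG _ t0.
  + exact: (lim0 (fun t => Im (mellin_kernel (s + 1) z t)) _ (fun t => (bound t).2) cy).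
  + exact: (lim0 (fun t => Im (mellin_kernel (s + 1) z t)) _ (fun t => (bound t).2) c0).
Qed.

(** Near x the real part of z + u w stays above b, half of its value at x; hence the gamma
    density with rate b dominates the derivatives locally uniformly. *)
Lemma is_cderive_mellin s z w (x : R) : 0 < Re s -> 0 < Re (z + x%:C * w) ->
  is_cderive (fun u => mellin s (z + u%:C * w)) x (- w * mellin (s + 1) (z + x%:C * w)).
Proof.
move=> s0; set zeta := fun u : R => z + u%:C * w; rewrite -/(zeta x) => zx0.
have s10 : 0 < Re (s + 1) by rewrite ReD /= addr_gt0.
pose b := Re (zeta x) / 2.
have b0 : 0 < b by rewrite divr_gt0.
(* moving u by less than e changes Re (z + u w) by less than b; the + 1 covers Re w = 0 *)
pose e := b / (`|Re w| + 1).
have e0 : 0 < e by rewrite divr_gt0// ltr_wpDl.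
have zge u : u \in `](x - e), (x + e)[ -> b <= Re (zeta u).
  rewrite in_itv/= -ltr_distlC => ue.
  have -> : Re (zeta u) = Re (zeta x) + (u - x) * Re w.
    by rewrite /zeta !ReImE /=; ring.
  have : `|(u - x) * Re w| <= b.
    rewrite normrM (@le_trans _ _ (e * (`|Re w| + 1)))//.
      by rewrite ler_pM// ?lerDl// distrC ltW.
    by rewrite /e divfK// gt_eqF// ltr_wpDl.
  rewrite ler_norml /b => /andP[+ _]; lra.
have zpos u : u \in `](x - e), (x + e)[ -> 0 < Re (zeta u).
  by move=> /zge; exact: lt_le_trans.
have dz u : is_cderive zeta u w.
  have := is_cderiveD _ _ _ _ _ (is_cderive_cst z u)
    (is_cderiveZ w _ _ _ (is_cderive_real _ _ _ (is_derive_id u (1 : R)))).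
  rewrite add0r mulr1; under eq_fun do rewrite mulrC.
  by [].
have dk u t : 0 < t -> is_cderive (fun u => mellin_kernel s (zeta u) t) u
    (- w * mellin_kernel (s + 1) (zeta u) t).
  move=> t0; rewrite mellin_kernel_shift//.
  have H := is_cderive_cexp _ _ _ (is_cderiveD _ _ _ _ _
     (is_cderive_cst ((s - 1) * (ln t)%:C) u)
     (is_cderiveN _ _ _ (is_cderiveZ t%:C _ _ _ (dz u)))).
  by apply: (is_cderive_eq _ H); rewrite /mellin_kernel; ring.
pose G t : R := normc w * gamma_density (Re s + 1) b t.
have intG : mu.-integrable D (EFin \o G).
  apply: eq_integrable
    (integrableZl _ (normc w) (integrable_gamma_density (Re s + 1) b _ b0)) => //.
  by rewrite addr_gt0.
have G0 t : 0 <= G t by rewrite mulr_ge0 ?normc_ge0// expR_ge0.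
have Gub u t : u \in `](x - e), (x + e)[ -> D t ->
    normc (- w * mellin_kernel (s + 1) (zeta u) t) <= G t.
  rewrite /= [t \in _]in_itv/= andbT => ux t0.
  rewrite Normc.normcM normc_opp normc_mellin_kernel ler_wpM2l ?normc_ge0// ReD /=.
  by rewrite ler_expR lerD2l lerN2 ler_pM2r// zge.
have xI : x \in `](x - e), (x + e)[ by rewrite in_itv/= ltrBlDr !ltrDl e0.
have mD : measurable D by exact: measurable_itv.
have -> : - w * mellin (s + 1) (zeta x) =
    cintegral mu D (fun t => - w * mellin_kernel (s + 1) (zeta x) t).
  by rewrite cintegralZ//; exact: cintegrable_mellin_kernel.
split.
- apply: (is_derive_under_integral _ _ _ mu D (fun u t => Re (mellin_kernel s (zeta u) t))
   (fun u t => Re (- w * mellin_kernel (s + 1) (zeta u) t)) G _ _ _ mD xI) => //.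
  + by move=> r rI; have [] := cintegrable_mellin_kernel _ _ s0 (zpos _ rI).
  + by move=> r t rI; rewrite /= in_itv/= andbT => t0; have [] := dk r t t0.
  + by move=> r t rI Dt; rewrite (le_trans (le_Re_normc _))// Gub.
- apply: (is_derive_under_integral _ _ _ mu D (fun u t => Im (mellin_kernel s (zeta u) t))
   (fun u t => Im (- w * mellin_kernel (s + 1) (zeta u) t)) G _ _ _ mD xI) => //.
  + by move=> r rI; have [] := cintegrable_mellin_kernel _ _ s0 (zpos _ rI).
  + by move=> r t rI; rewrite /= in_itv/= andbT => t0; have [] := dk r t t0.
  + by move=> r t rI Dt; rewrite (le_trans (le_Im_normc _))// Gub.
Qed.

Lemma clog_real t : 0 < t -> clog t%:C = (ln t)%:C.
Proof.
move=> t0; rewrite clog_right_half//= mul0r atan0 expr0n addr0 expr2 lnM ?posrE//.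
by congr (_ +i* _); field.
Qed.

Lemma derive0_segment_eq (h : R -> R) :
  (forall u : R, 0 <= u <= 1 -> is_derive u 1 h 0) -> h 1 = h 0.
Proof.
move=> dh.
have ch : {within `[0, 1], continuous h}.
  apply: derivable_within_continuous => u; rewrite in_itv/= => uI.
  by have [] := dh _ uI.
have dh' (u : R) : u \in `]0, 1[ -> is_derive u 1 h 0.
  by rewrite in_itv/= => /andP[u0 u1]; apply: dh; rewrite !ltW.
have [c _ /eqP] := MVT (@ltr01 R) dh' ch.
by rewrite mul0r subr_eq0 => /eqP.
Qed.

(** F(zeta) zeta^s has derivative 0 along the segment from 1 to z, because
    (s / zeta) F(zeta) = F1(zeta) by [mellinS]. *)
Lemma mellin_pow s z : 0 < Re s -> 0 < Re z -> mellin s z = cGamma s * cpow z (- s).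
Proof.
move=> s0 z0.
have -> : cGamma s = mellin s 1.
  apply: eq_cintegral => t /set_mem /=; rewrite in_itv/= andbT => t0.
  rewrite /cpow clog_real// /mellin_kernel cexpD mulr1; congr (_ * _).
  by rewrite -cexp_real rmorphN.
pose zeta (u : R) := 1 + u%:C * (z - 1).
have zpos u : 0 <= u <= 1 -> 0 < Re (zeta u).
  move=> /andP[u0 u1]; rewrite /zeta !ReImE /= mul0r subr0.
  (* a convex combination of 1 and Re z *)
  have [h|h] := leP u (1/2); nra.
have dz u : is_cderive zeta u (z - 1).
  have := is_cderiveD _ _ _ _ _ (is_cderive_cst 1 u)
    (is_cderiveZ (z - 1) _ _ _ (is_cderive_real _ _ _ (is_derive_id u (1 : R)))).
  rewrite add0r mulr1; under eq_fun do rewrite mulrC.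
  by [].
pose Phi u := mellin s (zeta u) * cexp (s * clog (zeta u)).
have dPhi u : 0 <= u <= 1 -> is_cderive Phi u 0.
  move=> uI; have zu0 := zpos _ uI.
  have H := is_cderiveM _ _ _ _ _ (is_cderive_mellin s 1 (z - 1) u s0 zu0)
    (is_cderive_cexp _ _ _ (is_cderiveZ s _ _ _ (is_cderive_clog _ _ _ (dz u) zu0))).
  apply: (is_cderive_eq _ H).
  have zn0 : zeta u != 0 by apply: contraTneq zu0 => ->; rewrite ltxx.
  have E : s * mellin s (zeta u) / zeta u = mellin (s + 1) (zeta u).
    by rewrite mellinS// mulrAC divff// mul1r.
  rewrite -/(zeta u) -E; field.
  exact: zn0.
have Phi01 : Phi 1 = Phi 0.
  apply: complex_ext.
  - by apply: (derive0_segment_eq (fun u => Re (Phi u))) => u uI; have [] := dPhi _ uI.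
  - by apply: (derive0_segment_eq (fun u => Im (Phi u))) => u uI; have [] := dPhi _ uI.
move: Phi01; rewrite /Phi /zeta mul1r mul0r addr0 addrC subrK.
have -> : clog 1 = 0 :> R[i] by rewrite (clog_real 1)// ln1.
rewrite mulr0 cexp0 mulr1 => <-.
by rewrite -mulrA /cpow -cexpD mulNr subrr cexp0 mulr1.
Qed.

End mellin_transform.

(** * Exchanging an integral and an expectation *)

Section dominated_fubini.
Context d1 d2 (T1 : measurableType d1) (T2 : measurableType d2) {R : realType}.
Variables (m : {sigma_finite_measure set T1 -> \bar R}) (P : probability T2 R).
Variables (D : set T1) (mD : measurable D).

Section real.
Variables (f : T1 -> T2 -> R) (h : T1 -> R).
Hypothesis mf : measurable_fun setT (fun p : T1 * T2 => f p.1 p.2).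
Hypothesis ih : m.-integrable D (EFin \o h).
Hypothesis fh : forall t w, D t -> `|f t w| <= h t.

Lemma integrable_section2 t : D t -> P.-integrable setT (EFin \o f t).
Proof.
move=> Dt; apply: le_integrable (finite_measure_integrable_cst P (h t) measurableT) => //.
  apply/measurable_EFinP.
  exact: (measurable_fun_pair2 (f := fun p => f p.1 p.2)).
by move=> w _; rewrite lee_fin /= (le_trans (fh _ _ Dt))// ler_norm.
Qed.

Lemma integrable_section1 w : m.-integrable D (EFin \o f ^~ w).
Proof.
apply: le_integrable ih => //.
  apply/measurable_EFinP/measurable_funTS.
  exact: (measurable_fun_pair1 (f := fun p => f p.1 p.2)).
by move=> t Dt; rewrite lee_fin /= (le_trans (fh _ _ Dt))// ler_norm.
Qed.

(** The integrand is extended by 0 outside D, so that Fubini's theorem for the whole product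
    space applies. *)
Lemma dominated_fubini :
  m.-integrable D (EFin \o (fun t => Rintegral P setT (f t))) /\
  Rintegral m D (fun t => Rintegral P setT (f t)) =
  Rintegral P setT (fun w => Rintegral m D (f ^~ w)).
Proof.
pose F (p : T1 * T2) : \bar R := ((f p.1 p.2)%:E * (\1_D p.1)%:E)%E.
have mF : measurable_fun setT F.
  apply: emeasurable_funM; first exact/measurable_EFinP.
  apply/measurable_EFinP; apply: measurableT_comp; last exact: measurable_fst.
  exact: measurable_indic.
have FDw t w : D t -> F (t, w) = (f t w)%:E.
  by move=> Dt; rewrite /F /= indicE mem_set//= mule1.
have FnDw t w : ~ D t -> F (t, w) = 0%E.
  by move=> Dt; rewrite /F /= indicE memNset//= mule0.
have FD t : D t -> (fun w => F (t, w)) = EFin \o f t.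
  by move=> Dt; apply/funext => w; exact: FDw.
have FnD t : ~ D t -> (fun w => F (t, w)) = cst 0%E.
  by move=> Dt; apply/funext => w; exact: FnDw.
have inner : (fun t => \int[P]_w F (t, w))%E =
    (EFin \o (fun t => Rintegral P setT (f t))) \_ D.
  apply/funext => t; rewrite patchE; case: ifPn => [/set_mem Dt|/negP Dt].
    rewrite FD//= fineK//.
    exact: (integrable_fin_num measurableT (integrable_section2 _ Dt)).
  by rewrite FnD ?integral0//; move/mem_set.
have outer w : (\int[m]_t F (t, w))%E = (Rintegral m D (f ^~ w))%:E.
  rewrite fineK; last exact: (integrable_fin_num mD (integrable_section1 w)).
  rewrite [RHS]integral_mkcond; apply: eq_integral => t _; rewrite patchE.
  case: ifPn => [/set_mem Dt|/negP Dt]; first by rewrite FDw.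
  by rewrite FnDw//; move/mem_set.
have iF : (m \x P)%E.-integrable setT F.
  apply/(integrable12ltyP _ _ mF).
  apply: (@le_lt_trans _ _ (\int[m]_(t in D) (h t)%:E)%E); last exact: integrable_lty.
  rewrite [leRHS]integral_mkcond; apply: ge0_le_integral => //.
  - by move=> t _; exact: integral_ge0.
  - apply: (measurable_fun_fubini_tonelli_F (fun p => `|F p|%E)) => //.
    exact: measurableT_comp.
  - by apply/(measurable_restrictT _ mD); have /integrableP[] := ih.
  move=> t _; rewrite patchE; case: ifPn => [/set_mem Dt|/negP Dt].
    have -> : (fun w => `|F (t, w)|%E) = (fun w => (`|f t w|)%:E).
      by apply/funext => w; rewrite FDw.
    rewrite (@le_trans _ _ (\int[P]_(w in setT) (h t)%:E)%E)//.
      apply: ge0_le_integral => //.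
      - have /integrableP[/measurable_EFinP mft _] := integrable_section2 _ Dt.
        by apply/measurable_EFinP; exact: measurableT_comp.
      - by move=> w _; rewrite lee_fin fh.
    by rewrite integral_cst// [X in (_ * X)%E](@probability_setT _ _ _ P) mule1.
  rewrite (_ : (fun w => `|F (t, w)|%E) = cst 0%E) ?integral0//.
  apply/funext => w; rewrite FnDw ?abse0//.
  by move/mem_set.
split.
  by apply/(integrable_mkcond _ mD); rewrite -inner; exact: integrable_fubini_F iF.
rewrite {1}/Rintegral integral_mkcond -[X in (\int[m]_t X t)%E]inner (Fubini iF).
by congr fine; apply: eq_integral => w _; exact: outer.
Qed.

End real.

Lemma dominated_cfubini (f : T1 -> T2 -> R[i]) (h : T1 -> R) :
  cmeasurable setT (fun p : T1 * T2 => f p.1 p.2) ->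
  m.-integrable D (EFin \o h) ->
  (forall t w, D t -> Normc.normc (f t w) <= h t) ->
  cintegrable m D (fun t => cintegral P setT (f t)) /\
  cintegral m D (fun t => cintegral P setT (f t)) =
  cintegral P setT (fun w => cintegral m D (f ^~ w)).
Proof.
move=> [mr mi] ih fh.
have [r1 r2] := dominated_fubini _ h mr ih
  (fun t w Dt => le_trans (le_Re_normc _) (fh t w Dt)).
have [i1 i2] := dominated_fubini _ h mi ih
  (fun t w Dt => le_trans (le_Im_normc _) (fh t w Dt)).
by split; [split|apply: complex_ext].
Qed.

End dominated_fubini.

(** * Symmetric distributions *)

Section symmetric.
Context (d : measure_display) (T : measurableType d) (R : realType).
Variables (P : probability T R) (X : {RV P >-> R}).
Local Notation Im := (@complex.Im R).

Lemma symmetric_bounded_integral (g : R -> R) (M : R) : symmetric_RV X ->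
  measurable_fun setT g -> (forall x, `|g x| <= M) ->
  Rintegral P setT (fun w => g (X w)) = Rintegral P setT (fun w => g (- X w)).
Proof.
move=> symX mg gM.
have mX : measurable_fun setT X by [].
have mNX : measurable_fun setT (fun w => - X w) by exact: measurable_funN.
have intg (Y : T -> R) : measurable_fun setT Y -> P.-integrable setT ((EFin \o g) \o Y).
  move=> mY; apply: le_integrable (finite_measure_integrable_cst P M measurableT) => //.
    by apply/measurable_EFinP; exact: measurableT_comp.
  by move=> w _; rewrite lee_fin /= (le_trans (gM _))// ler_norm.
have mEg : measurable_fun setT (EFin \o g) by exact/measurable_EFinP.
rewrite /Rintegral; congr fine.
rewrite -(integral_pushforward mX mEg (intg _ mX) measurableT).
rewrite -(integral_pushforward mNX mEg (intg _ mNX) measurableT).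
by apply: eq_measure_integral => A mA _; exact: symX.
Qed.

(** Conjugation of the exponential is the substitution of - X for X. *)
Lemma char_fun_symmetric t : symmetric_RV X ->
  char_fun X t = cexpectation P (fun w => cexp (0 +i* (- (t * X w)))).
Proof.
move=> symX; rewrite /char_fun /cexpectation /cintegral; congr (_ +i* _).
- by apply: eq_Rintegral => w _; rewrite !ReM /= cosN; ring.
- rewrite (symmetric_bounded_integral (fun x => Im (cexp (0 +i* (t * x)))) 1 symX).
  + by apply: eq_Rintegral => w _; rewrite mulrN.
  + have mt : cmeasurable (setT : set R) (fun x : R => 0 +i* (t * x)).
      by split => //=; exact: measurable_funM.
    by have [] := cmeasurable_cexp _ _ _ _ mt.
  + move=> x; rewrite (le_trans (le_Im_normc _))// normc_cexp /= expR0//.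
Qed.

End symmetric.

(** * The Mellin transform of the damped characteristic function *)

Section mellin_char_fun.
Context (d : measure_display) (T : measurableType d) (R : realType).
Variables (P : probability T R) (X : {RV P >-> R}) (a : R).
Hypothesis a_gt0 : 0 < a.
Local Notation mu := (@lebesgue_measure R).
Local Notation D := (`]0, +oo[%classic : set R).
Local Notation Re := (@complex.Re R).
Local Notation Im := (@complex.Im R).
Local Notation normc := (@Normc.normc R).

Lemma bounded_cintegrable (f : T -> R[i]) (M : R) : cmeasurable setT f ->
  (forall w, normc (f w) <= M) -> cintegrable P setT f.
Proof.
move=> mf fM; apply: (@le_cintegrable _ _ _ P setT _ _ (cst M)) => //.
exact: finite_measure_integrable_cst.
Qed.

(** Symmetry changes e^{itX} into e^{-itX}, which combines with e^{-at} into e^{-t(a+iX)}. *)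
Lemma laplace_char_fun t : symmetric_RV X ->
  (expR (- a * t))%:C * char_fun X t =
  cexpectation P (fun w => cexp (- (t%:C * (a +i* X w)))).
Proof.
move=> symX; rewrite char_fun_symmetric// -cintegralZ//.
  apply: eq_cintegral => w _; rewrite -cexp_real -cexpD; congr cexp.
  by apply: complex_ext; rewrite !ReImE /=; ring.
apply: (bounded_cintegrable _ 1).
  apply: cmeasurable_cexp; split => //=.
  by apply: measurable_funN; exact: measurable_funM.
by move=> w; rewrite normc_cexp /= expR0.
Qed.

Lemma cexp_bound_cintegrable t : 0 <= t ->
  cintegrable P setT (fun w => cexp (- (t%:C * (a +i* X w)))).
Proof.
move=> t0; apply: (bounded_cintegrable _ 1).
  apply: cmeasurable_cexp; split => /=; apply: measurable_funN.
    by apply: measurable_funB => //; exact: measurable_funM.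
  by apply: measurable_funD => //; exact: measurable_funM.
move=> w; rewrite normc_cexp -expR0 ler_expR ReN ReM /= mul0r subr0 oppr_le0.
by rewrite mulr_ge0// ltW.
Qed.

Lemma mellin_integrand s t : symmetric_RV X -> 0 < t ->
  cpow t%:C (s - 1) * (expR (- a * t))%:C * char_fun X t =
  cintegral P setT (fun w => mellin_kernel s (a +i* X w) t).
Proof.
move=> symX t0; rewrite -mulrA laplace_char_fun// -cintegralZ//.
  by apply: eq_cintegral => w _; rewrite /cpow clog_real// -cexpD.
exact/cexp_bound_cintegrable/ltW.
Qed.

Lemma measurable_atan : measurable_fun setT (@atan R).
Proof. by apply: continuous_measurable_fun => x; exact: continuous_atan. Qed.

(** The power is bounded on the line Re z = a: its modulus is |z|^{-Re s} e^{Im s arg z}, where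
    |z| >= a and |arg z| <= pi/2. *)
Lemma cintegrable_cpow s : 0 < Re s ->
  cintegrable P setT (fun w => cpow (a +i* X w) (- s)).
Proof.
move=> s0; pose M := expR (- Re s * (ln (a ^+ 2) / 2) + `|Im s| * (pi / 2)).
apply: (bounded_cintegrable _ M).
  apply: cmeasurable_cexp; apply: cmeasurableM; first exact: cmeasurable_cst.
  have -> : (fun w => clog (a +i* X w)) =
      (fun w => (ln (a ^+ 2 + X w ^+ 2) / 2) +i* atan (X w / a)).
    by apply/funext => w; rewrite clog_right_half.
  split => /=.
    apply: measurable_funM => //; apply: measurableT_comp; first exact: measurable_ln.
    by apply: measurable_funD => //; exact: measurable_funX.
  by apply: measurableT_comp; [exact: measurable_atan|exact: measurable_funM].
move=> w; rewrite /cpow normc_cexp clog_right_half// ler_expR.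
rewrite !ReImE /= [- Im s * _]mulNr opprK; apply: lerD.
  rewrite !mulNr lerN2 ler_pM2l// ler_pM2r// ler_ln ?posrE ?exprn_gt0//.
    by rewrite lerDl sqr_ge0.
  by rewrite ltr_pwDl ?exprn_gt0// sqr_ge0.
rewrite (le_trans (ler_norm _))// normrM ler_wpM2l//.
by rewrite ler_norml !ltW ?atan_gtNpi2 ?atan_ltpi2.
Qed.

Lemma mellin_char_fun s : symmetric_RV X -> 0 < Re s ->
  let f t := cpow t%:C (s - 1) * (expR (- a * t))%:C * char_fun X t in
  cintegrable mu D f /\
  cintegral mu D f = cGamma s * cexpectation P (fun w => cpow (a +i* X w) (- s)).
Proof.
move=> symX s0 f.
have fE : {in D, (fun t => cintegral P setT (fun w => mellin_kernel s (a +i* X w) t)) =1 f}.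
  by move=> t /set_mem /=; rewrite in_itv/= andbT => t0; rewrite /f mellin_integrand.
have mk : cmeasurable setT (fun p : measurableTypeR R * T =>
    mellin_kernel s (a +i* X p.2) p.1).
  apply: cmeasurable_cexp; apply: cmeasurableD.
    apply: cmeasurableM; first exact: cmeasurable_cst.
    apply: cmeasurable_real; apply: measurableT_comp; first exact: measurable_ln.
    exact: measurable_fst.
  under eq_fun do rewrite -mulrN.
  apply: cmeasurableM; first by apply: cmeasurable_real; exact: measurable_fst.
  split => //=; apply: measurable_funN.
  by apply: measurableT_comp => //; exact: measurable_snd.
have mD : measurable (D : set (measurableTypeR R)) by exact: measurable_itv.
have ig : mu.-integrable D (EFin \o gamma_density (Re s) a).
  exact: integrable_gamma_density.
have kb t w : D t -> normc (mellin_kernel s (a +i* X w) t) <= gamma_density (Re s) a t.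
  by rewrite normc_mellin_kernel.
have [i1 i2] := @dominated_cfubini _ _ (measurableTypeR R) T R mu P D mD
  (fun t w => mellin_kernel s (a +i* X w) t) (gamma_density (Re s) a) mk ig kb.
split; first exact: (eq_cintegrable _ (measurableTypeR R) _ _ mD _ _ fE i1).
rewrite -(eq_cintegral _ (measurableTypeR R) _ _ _ _ fE) i2.
rewrite -cintegralZ//; last exact: cintegrable_cpow.
by apply: eq_cintegral => w _; rewrite -mellin_pow.
Qed.

End mellin_char_fun.

(** * Abel's limit theorem *)

Section abel.
Context {R : realType}.
Implicit Types (c : R^nat) (l r : R).

Lemma summation_by_parts c l r n :
  series (fun k => c k * r ^+ k) n - l =
  (series c n - l) * r ^+ n + (1 - r) * \sum_(k < n) (series c k.+1 - l) * r ^+ k.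
Proof.
elim: n => [|n ih].
  by rewrite /series /= !big_geq// big_ord0 expr0; ring.
rewrite /series /= !big_nat_recr//= big_ord_recr /= -/(series c n).
rewrite -[\sum_(0 <= i < n) (c i * _)]/(series (fun k => c k * r ^+ k) n).
rewrite addrAC ih /series /= big_nat_recr//= -/(series c n) exprS; ring.
Qed.

(** The terms of index below M are bounded by B, which costs (1 - r) B M at most; the others are
    bounded by e, and (1 - r) times the geometric sum is at most 1. *)
Lemma abel_tail_le (u : R^nat) (B e r : R) (M n : nat) : 0 <= r <= 1 -> 0 <= B -> 0 <= e ->
  (forall k, `|u k| <= B) -> (forall k, (M <= k)%N -> `|u k| <= e) ->
  (1 - r) * \sum_(k < n) `|u k| * r ^+ k <=
    (1 - r) * (B * (minn n M)%:R) + e * (1 - r ^+ n).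
Proof.
move=> /andP[r0 r1] B0 e0 uB ue; elim: n => [|n ih].
  by rewrite big_ord0 min0n expr0 subrr !mulr0 addr0.
rewrite big_ord_recr /= mulrDr.
have rn0 : 0 <= r ^+ n by rewrite exprn_ge0.
have rn1 : r ^+ n <= 1 by rewrite exprn_ile1.
have r10 : 0 <= 1 - r by rewrite subr_ge0.
have [Mn|nM] := leqP M n.
  have -> : minn n.+1 M = minn n M by rewrite (minn_idPr Mn) (minn_idPr (leqW Mn)).
  have h : (1 - r) * (`|u n| * r ^+ n) <= (1 - r) * (e * r ^+ n).
    by rewrite ler_wpM2l// ler_wpM2r// ue.
  by rewrite exprS; move: ih h; nra.
have -> : (minn n.+1 M)%:R = (minn n M)%:R + 1 :> R.
  by rewrite (minn_idPl nM) (minn_idPl (ltnW nM)) natr1.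
have h : (1 - r) * (`|u n| * r ^+ n) <= (1 - r) * B.
  rewrite ler_wpM2l// (le_trans _ (uB n))//; by rewrite ler_piMr.
have h2 : e * (1 - r ^+ n) <= e * (1 - r ^+ n.+1).
  by rewrite ler_wpM2l// lerD2l lerN2 exprS ler_piMl.
by move: ih h h2; lra.
Qed.

Lemma abel_limit c l (v : R -> R) : series c @ \oo --> l ->
  (forall r, 0 < r < 1 -> series (fun k => c k * r ^+ k) @ \oo --> v r) ->
  v r @[r --> 1^'-] --> l.
Proof.
move=> cl cv.
pose u n := series c n - l.
have u0 : u n @[n --> \oo] --> (0 : R).
  by rewrite -(subrr l); apply: cvgB; [exact: cl|exact: cvg_cst].
have [B B0 uB] : exists2 B : R, 0 < B & forall n, `|u n| <= B.
  have [B [_ HB]] := cvg_seq_bounded (cvgP _ u0).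
  exists (`|B| + 1); first by rewrite ltr_wpDl.
  by move=> n; apply: HB => //; rewrite (le_lt_trans (ler_norm _))// ltrDl.
apply/cvgrPdist_le => e e0.
have e20 : 0 < e / 2 by rewrite divr_gt0.
have [M _ HM] : \forall n \near \oo, `|u n| <= e / 2.
  by move/cvgrPdist_le : u0 => /(_ _ e20); apply: filterS => n; rewrite sub0r normrN.
near=> r.
have r01 : 0 < r < 1.
  by apply/andP; split; near: r; [exact: nbhs_left_gt|exact: nbhs_left_lt].
have rM : (1 - r) * (B * M%:R) <= e / 2.
  have : 1 - r <= e / 2 / (B * M%:R + 1).
    rewrite lerBlDl -lerBlDr; near: r; apply: nbhs_left_ge.
    by rewrite ltrBlDr ltrDl divr_gt0// ltr_wpDl// mulr_ge0// ltW.
  rewrite ler_pdivlMr ?ltr_wpDl ?mulr_ge0 ?(ltW B0)//; move: r01 => /andP[]; nra.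
rewrite distrC; have /andP[r0 r1] := r01.
have bound n : `|series (fun k => c k * r ^+ k) n - l| <= B * r ^+ n + e.
  rewrite summation_by_parts (le_trans (ler_normD _ _))//; apply: lerD.
    rewrite normrM (ger0_norm (exprn_ge0 n (ltW r0))).
    by rewrite ler_wpM2r ?exprn_ge0 ?(ltW r0)//; exact: uB.
  rewrite normrM ger0_norm ?subr_ge0 ?(ltW r1)//.
  have r01' : 0 <= r <= 1 by rewrite !ltW.
  have tail := @abel_tail_le (fun k => u k.+1) B (e / 2) r M n r01' (ltW B0) (ltW e20)
    (fun k => uB k.+1) (fun k Mk => HM k.+1 (leqW Mk)).
  have mM : (minn n M)%:R <= M%:R :> R by rewrite ler_nat geq_minr.
  have h1 : (1 - r) * (B * (minn n M)%:R) <= e / 2.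
    by apply: le_trans rM; rewrite ler_wpM2l ?subr_ge0 ?(ltW r1)// ler_wpM2l// ltW.
  have h2 : e / 2 * (1 - r ^+ n) <= e / 2.
    by rewrite ler_piMr ?(ltW e20)// lerBlDr lerDl exprn_ge0// ltW.
  have h3 : (1 - r) * `|\sum_(k < n) (series c k.+1 - l) * r ^+ k| <=
     (1 - r) * \sum_(k < n) `|u k.+1| * r ^+ k.
    rewrite ler_wpM2l ?subr_ge0 ?(ltW r1)// (le_trans (ler_norm_sum _ _ _))//.
    by apply: ler_sum => k _; rewrite normrM (ger0_norm (exprn_ge0 _ (ltW r0))).
  by move: tail h1 h2 h3; lra.
have lim1 : (fun n => `|series (fun k => c k * r ^+ k) n - l|) @ \oo --> `|v r - l|.
  by apply: cvg_norm; apply: cvgB; [exact: cv|exact: cvg_cst].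
have lim2 : (fun n => B * r ^+ n + e) @ \oo --> e.
  rewrite -[X in _ --> X]add0r -[X in _ --> X + _](mulr0 B).
  apply: cvgD; last exact: cvg_cst.
  by apply: cvgM; [exact: cvg_cst|apply: cvg_expr; rewrite ger0_norm// ltW].
by apply: ler_cvg_to lim1 lim2 _; exact: nearW.
Unshelve. all: by end_near. Qed.

End abel.

(** * Convergence of complex sequences and partial sums of the exponential *)

Section complex_convergence.
Context {R : realType}.
Local Notation normc := (@Normc.normc R).
Local Notation Re := (@complex.Re R).
Local Notation Im := (@complex.Im R).

Lemma cvg_complex_normc (u : nat -> R[i]^o) (l : R[i]^o) :
  (fun n => normc (u n - l)) @ \oo --> (0 : R) -> u @ \oo --> l.
Proof.
move=> ul; apply/cvgrPdist_le => e e0.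
have eE : e = (Re e)%:C by apply: complex_ext => //=; rewrite ger0_Im ?ltW.
have re0 : 0 < Re e by move: e0; rewrite ltcE /= => /andP[].
move/cvgrPdist_le : ul => /(_ _ re0); apply: filterS => n.
rewrite sub0r normrN ger0_norm ?normc_ge0// => h.
by rewrite eE normr_normc lecR -opprB normc_opp.
Qed.

Lemma cvg_normc_complex (u : nat -> R[i]^o) (l : R[i]^o) :
  u @ \oo --> l -> (fun n => normc (u n - l)) @ \oo --> (0 : R).
Proof.
move=> /cvgrPdist_le ul; apply/cvgrPdist_le => e e0.
have e0' : 0 < e%:C by rewrite ltcR.
have := ul _ e0'; apply: filterS => n.
by rewrite normr_normc lecR sub0r normrN ger0_norm ?normc_ge0// -opprB normc_opp.
Qed.

Lemma cvg_Re_Im (u : nat -> R[i]^o) (l : R[i]^o) : u @ \oo --> l ->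
  (fun n => Re (u n)) @ \oo --> Re l /\ (fun n => Im (u n)) @ \oo --> Im l.
Proof.
move=> /cvg_normc_complex ul; split; apply/cvgrPdist_le => e e0;
  move/cvgrPdist_le : ul => /(_ _ e0); apply: filterS => n;
  rewrite sub0r normrN (ger0_norm (normc_ge0 _)) => h; rewrite distrC.
- by rewrite -ReN -ReD (le_trans (le_Re_normc _)).
- by rewrite -ImN -ImD (le_trans (le_Im_normc _)).
Qed.

Lemma series_Re (u : nat -> R[i]^o) n : Re (series u n) = series (fun k => Re (u k)) n.
Proof.
rewrite /series /=; elim/big_ind2 : _ => // x1 x2 y1 y2 <- <-; exact: ReD.
Qed.

Lemma series_Im (u : nat -> R[i]^o) n : Im (series u n) = series (fun k => Im (u k)) n.
Proof.
rewrite /series /=; elim/big_ind2 : _ => // x1 x2 y1 y2 <- <-; exact: ImD.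
Qed.

End complex_convergence.

Section exponential_series.
Context {R : realType}.

Lemma expR_partial_sum_le (y : R) n : 0 <= y -> \sum_(k < n) y ^+ k / k`!%:R <= expR y.
Proof.
move=> y0; have nd : nondecreasing_seq (series (exp_coeff y)).
  by apply: nondecreasing_series => k _ _; exact: exp_coeff_ge0.
have := nondecreasing_cvgn_le nd (is_cvg_series_exp_coeff y) n.
by rewrite /series /= big_mkord.
Qed.

Lemma expR_term_le (y : R) n : 0 <= y -> y ^+ n / n`!%:R <= expR y.
Proof.
move=> y0; apply: le_trans (expR_partial_sum_le _ n.+1 y0).
rewrite big_ord_recr /= lerDr sumr_ge0// => i _.
by rewrite divr_ge0// exprn_ge0.
Qed.

End exponential_series.

(** * The moment series *)

Section moment_series.
Context (d : measure_display) (T : measurableType d) (R : realType).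
Variables (P : probability T R) (X : {RV P >-> R}) (a : R).
Hypothesis a_gt0 : 0 < a.
Hypothesis X_sym : symmetric_RV X.
Hypothesis X_mom : finite_moments X.
Local Notation Re := (@complex.Re R).
Local Notation Im := (@complex.Im R).
Local Notation normc := (@Normc.normc R).

Let f (t : R) : R[i] := (expR (- a * t))%:C * char_fun X t.

Lemma expectation_lty_integrable (g : T -> R) : measurable_fun setT g ->
  (forall w, 0 <= g w) -> ('E_P[g] < +oo)%E -> P.-integrable setT (EFin \o g).
Proof.
move=> mg g0 Eg; apply/integrableP; split; first exact/measurable_EFinP.
rewrite unlock in Eg; apply: le_lt_trans Eg.
by under eq_integral => w _ do rewrite /= ger0_norm//.
Qed.

Lemma integrable_abs_moment n : P.-integrable setT (EFin \o (fun w => `|X w| ^+ n)).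
Proof.
apply: expectation_lty_integrable; [|by move=> w; rewrite exprn_ge0|exact: X_mom].
by apply: measurable_funX; exact: measurableT_comp.
Qed.

Lemma measurable_shift_power n : measurable_fun setT (fun w => (a + `|X w|) ^+ n).
Proof. by apply: measurable_funX; apply: measurable_funD => //; exact: measurableT_comp. Qed.

Lemma integrable_shift_power n : P.-integrable setT (EFin \o (fun w => (a + `|X w|) ^+ n)).
Proof.
have i1 : P.-integrable setT (EFin \o (fun _ : T => a ^+ n)).
  exact: finite_measure_integrable_cst.
have := integrable_lincomb _ _ _ _ measurableT (2 ^+ n) (2 ^+ n) _ _
  i1 (integrable_abs_moment n).
apply: le_integrable => //.
  by apply/measurable_EFinP; exact: measurable_shift_power.
move=> w _ /=; rewrite lee_fin [leLHS]ger0_norm ?exprn_ge0 ?addr_ge0 ?(ltW a_gt0)//.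
apply: le_trans (ler_norm _); rewrite -mulrDr.
have [h|h] := leP a `|X w|.
- rewrite (@le_trans _ _ (2 ^+ n * `|X w| ^+ n))//.
    by rewrite -exprMn lerXn2r ?nnegrE ?addr_ge0 ?mulr_ge0 ?(ltW a_gt0)//; lra.
  by rewrite ler_wpM2l ?exprn_ge0// lerDr exprn_ge0// ltW.
- rewrite (@le_trans _ _ (2 ^+ n * a ^+ n))//.
    by rewrite -exprMn lerXn2r ?nnegrE ?addr_ge0 ?mulr_ge0 ?(ltW a_gt0)//; lra.
  by rewrite ler_wpM2l ?exprn_ge0// lerDl exprn_ge0// ltW.
Qed.

Lemma normc_shift_le w : normc (a +i* X w) <= a + `|X w|.
Proof. by rewrite (le_trans (le_normc_ReIm _))//= ger0_norm// ltW. Qed.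

Lemma normc_shift_power_le w n : normc (a +i* X w) ^+ n <= (a + `|X w|) ^+ n.
Proof.
by rewrite lerXn2r ?nnegrE ?normc_ge0 ?addr_ge0 ?(ltW a_gt0)// normc_shift_le.
Qed.

Lemma cintegrable_power n : cintegrable P setT (fun w => (a +i* X w) ^+ n).
Proof.
apply: (@le_cintegrable _ _ _ P setT _ _ (fun w => (a + `|X w|) ^+ n)) => //.
- by apply: cmeasurableX; split.
- exact: integrable_shift_power.
- by move=> w _; rewrite normcX normc_shift_power_le.
Qed.

(** It majorizes the absolute moments of a + iX and expands in the moments of |X|. *)
Definition shift_moment n : R := Rintegral P setT (fun w => (a + `|X w|) ^+ n).

Lemma moment_termE t n :
  moment_term X a t n =
  ((- t) ^+ n / n`!%:R)%:C * cintegral P setT (fun w => (a +i* X w) ^+ n).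
Proof.
rewrite /moment_term natcE -rmorphXn /= mulrAC; congr (_ * _).
by rewrite rmorphM /= fmorphV.
Qed.

Lemma laplace_remainderE t N : 0 <= t ->
  f t - series (moment_term X a t) N =
  cintegral P setT (fun w => cexp_rem (- (a +i* X w)) N t).
Proof.
move=> t0.
pose g (k : 'I_N) w : R[i] := ((- t) ^+ k / k`!%:R)%:C * (a +i* X w) ^+ k.
have ig k : cintegrable P setT (g k) by apply: cintegrableZ => //; exact: cintegrable_power.
have [is1 is2] := cintegral_sum _ _ P setT measurableT _ (index_enum 'I_N) g ig.
have -> : (fun w => cexp_rem (- (a +i* X w)) N t) =
    (fun w => cexp (- (t%:C * (a +i* X w))) + (-1) * \sum_k g k w).
  apply/funext => w; rewrite /cexp_rem mulN1r mulrN; congr (_ - _).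
  apply: eq_bigr => k _; rewrite /g exprNn [(- t) ^+ k]exprNn.
  by rewrite -[in RHS]mulrA [in RHS]rmorphM /= rmorphXn /= rmorphN rmorph1 mulrCA mulrA.
rewrite cintegralD//; [|exact: cexp_bound_cintegrable|exact: cintegrableZ].
rewrite cintegralZ// is2 /f laplace_char_fun// mulN1r; congr (_ - _).
rewrite /series /= big_mkord; apply: eq_bigr => k _.
by rewrite moment_termE -cintegralZ//; exact: cintegrable_power.
Qed.

(** Expectation of the Taylor bound, as - (a + iX) has negative real part. *)
Lemma laplace_remainder_le t N : 0 <= t ->
  normc (f t - series (moment_term X a t) N) <= 2 * (shift_moment N * (t ^+ N / N`!%:R)).
Proof.
move=> t0; rewrite laplace_remainderE//.
have tN : 0 <= t ^+ N / N`!%:R by rewrite divr_ge0// exprn_ge0.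
have ib : P.-integrable setT (EFin \o (fun w => (a + `|X w|) ^+ N * (t ^+ N / N`!%:R))).
  apply: eq_integrable (integrableZl _ (t ^+ N / N`!%:R) (integrable_shift_power N))
    => // w _ /=.
  by rewrite -EFinM mulrC.
have kb w : normc (cexp_rem (- (a +i* X w)) N t) <= (a + `|X w|) ^+ N * (t ^+ N / N`!%:R).
  apply: le_trans (cexp_rem_le _ _ _ _ t0) _; first by rewrite /= oppr_le0 ltW.
  by rewrite normc_opp ler_wpM2r// normc_shift_power_le.
have mr : cmeasurable setT (fun w => cexp_rem (- (a +i* X w)) N t).
  have mZ : cmeasurable setT (fun w => - (a +i* X w)).
    by split => //=; exact: measurable_funN.
  apply: cmeasurableD.
    by apply: cmeasurable_cexp; apply: cmeasurableM => //; exact: cmeasurable_cst.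
  under eq_fun do rewrite -mulN1r.
  apply: cmeasurableM; first exact: cmeasurable_cst.
  elim: (index_enum _) => [|k r ih].
    by under eq_fun do rewrite big_nil; exact: cmeasurable_cst.
  under eq_fun do rewrite big_cons.
  apply: cmeasurableD => //; apply: cmeasurableM; first exact: cmeasurable_cst.
  exact: cmeasurableX.
have ir := @le_cintegrable _ _ _ P setT measurableT _ _ mr ib (fun w _ => kb w).
apply: le_trans (normc_cintegral_le _ _ P setT measurableT _ _ ir ib (fun w _ => kb w)) _.
by rewrite RintegralZr//; exact: integrable_shift_power.
Qed.

Lemma moment_asymptotics N : exists C : R, \forall t \near 0^'+,
  `|f t - series (moment_term X a t) N| <= (C * t ^+ N)%:C.
Proof.
exists (2 * (shift_moment N / N`!%:R)); near=> t.
have t0 : 0 <= t by near: t; exact: nbhs_right_ge.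
rewrite normr_normc lecR (le_trans (laplace_remainder_le _ _ t0))//.
by rewrite -!mulrA [_^-1 * _]mulrC.
Unshelve. all: by end_near. Qed.

(** Dominated convergence: (t (a + |X|))^N / N! tends to 0 pointwise, being the general term of
    an exponential series, and is at most e^{t(a + |X|)}. *)
Lemma exp_moment_remainder_cvg0 t : 0 <= t ->
  ('E_P[(fun w => expR (t * `|X w|))%R] < +oo)%E ->
  (fun N => shift_moment N * (t ^+ N / N`!%:R)) @ \oo --> (0 : R).
Proof.
move=> t0 Et.
have mE : measurable_fun setT (fun w => expR (t * `|X w|)).
  by apply: measurableT_comp => //; apply: measurable_funM => //; exact: measurableT_comp.
have iE := expectation_lty_integrable _ mE (fun w => expR_ge0 _) Et.
pose g N w : R := (t * (a + `|X w|)) ^+ N / N`!%:R.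
have gE N w : g N w = (a + `|X w|) ^+ N * (t ^+ N / N`!%:R).
  by rewrite /g exprMn mulrCA mulrA.
have tX0 w : 0 <= t * (a + `|X w|) by rewrite mulr_ge0// addr_ge0// ltW.
have [] := @dominated_convergence _ _ _ P setT measurableT (fun N w => (g N w)%:E) (cst 0%E)
  (fun w => ((expR (t * a))%:E * (EFin \o (fun w => expR (t * `|X w|))) w)%E).
- move=> N; apply/measurable_EFinP.
  rewrite (_ : g N = fun w => (a + `|X w|) ^+ N * (t ^+ N / N`!%:R)).
    by apply: measurable_funM => //; exact: measurable_shift_power.
  by apply/funext => w; exact: gE.
- exact: measurable_cst.
- apply: aeW => w _; apply: cvg_EFin; first exact: nearW.
  exact: cvg_exp_coeff.
- exact: integrableZl.
- apply: aeW => w N _ /=; rewrite lee_fin ger0_norm; last by rewrite divr_ge0// exprn_ge0.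
  by rewrite -expRD -mulrDr expR_term_le.
move=> _ _; rewrite integral0 => cv.
have E N : (\int[P]_w (g N w)%:E)%E = (shift_moment N * (t ^+ N / N`!%:R))%:E.
  have ig : P.-integrable setT (EFin \o g N).
    apply: eq_integrable (integrableZl _ (t ^+ N / N`!%:R) (integrable_shift_power N))
    => // w _ /=.
    by rewrite gE -EFinM mulrC.
  rewrite -RintegralZr//; last exact: integrable_shift_power.
  rewrite -[LHS]fineK; last exact: integrable_fin_num.
  by congr (fine _)%:E; apply: eq_integral => w _; rewrite gE.
by move: cv; under eq_fun do rewrite /= E; move/fine_cvg.
Qed.

Lemma moment_series_cvg t : 0 <= t ->
  ('E_P[(fun w => expR (t * `|X w|))%R] < +oo)%E ->
  series (moment_term X a t) @ \oo --> (f t : R[i]^o).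
Proof.
move=> t0 Et; apply: cvg_complex_normc.
have := exp_moment_remainder_cvg0 _ t0 Et => cv.
apply: (@squeeze_cvgr _ _ _ _ (cst 0) (fun N => 2 * (shift_moment N * (t ^+ N / N`!%:R)))).
- apply: nearW => N; rewrite normc_ge0 /= -opprB normc_opp; exact: laplace_remainder_le.
- exact: cvg_cst.
- by rewrite -(mulr0 2); apply: cvgM => //; exact: cvg_cst.
Qed.

End moment_series.

Arguments shift_moment {d T R P} X a n.

(** * Exponential moments below a point of convergence *)

Section radius.
Context (d : measure_display) (T : measurableType d) (R : realType).
Variables (P : probability T R) (X : {RV P >-> R}) (a : R).
Hypothesis a_gt0 : 0 < a.
Hypothesis X_sym : symmetric_RV X.
Hypothesis X_mom : finite_moments X.
Local Notation Re := (@complex.Re R).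
Local Notation Im := (@complex.Im R).
Local Notation normc := (@Normc.normc R).

Let f (t : R) : R[i] := (expR (- a * t))%:C * char_fun X t.

Lemma cvg_moment_series_bounded t : cvgn (series (moment_term X a t)) ->
  exists2 B : R, 0 <= B & forall n, normc (moment_term X a t n) <= B.
Proof.
move=> /cvg_series_cvg_0 /cvg_normc_complex cv.
have [B [_ HB]] := cvg_seq_bounded (cvgP _ cv).
exists (`|B| + 1); first by rewrite addr_ge0.
move=> n; have := HB (`|B| + 1); rewrite (le_lt_trans (ler_norm _)) ?ltrDl// => /(_ isT n I) /=.
by rewrite subr0 ger0_norm ?normc_ge0.
Qed.

(** Expand (iX)^n = ((a + iX) - a)^n.  After multiplication by t^n / n! the binomial coefficients
    split into the terms of the moment series, bounded by B, and those of e^{at}. *)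
Lemma imaginary_moment_le t B n : 0 <= t -> 0 <= B ->
  (forall k, normc (moment_term X a t k) <= B) ->
  normc (cintegral P setT (fun w => (0 +i* X w) ^+ n)) * (t ^+ n / n`!%:R) <=
  B * expR (a * t).
Proof.
move=> t0 B0 mB.
pose mm i := cintegral P setT (fun w => (a +i* X w) ^+ i).
have mmB i : t ^+ i / i`!%:R * normc (mm i) <= B.
  apply: le_trans (mB i); rewrite moment_termE Normc.normcM normc_real.
  by rewrite normrM normrX normrN ger0_norm// ger0_norm.
pose c (i : 'I_n.+1) : R := (- a) ^+ (n - i) * 'C(n, i)%:R.
pose g (i : 'I_n.+1) w : R[i] := (c i)%:C * (a +i* X w) ^+ i.
have ig i : cintegrable P setT (g i) by apply: cintegrableZ => //; exact: cintegrable_power.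
have [_ is2] := cintegral_sum _ _ P setT measurableT _ (index_enum 'I_n.+1) g ig.
have -> : (fun w => (0 +i* X w) ^+ n) = (fun w => \sum_i g i w).
  apply/funext => w; have -> : 0 +i* X w = (- a)%:C + (a +i* X w).
    by apply: complex_ext => /=; ring.
  rewrite exprDn; apply: eq_bigr => i _.
  by rewrite /g /c -mulr_natr natcE rmorphM rmorphXn mulrAC.
rewrite is2.
have -> : \sum_i cintegral P setT (g i) = \sum_i (c i)%:C * mm i.
  by apply: eq_bigr => i _; rewrite cintegralZ//; exact: cintegrable_power.
have tn0 k : 0 <= t ^+ k / k`!%:R by rewrite divr_ge0// exprn_ge0.
have normc_sum (s : seq 'I_n.+1) (F : 'I_n.+1 -> R[i]) :
    normc (\sum_(i <- s) F i) <= \sum_(i <- s) normc (F i).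
  elim/big_ind2 : _ => [|x1 x2 y1 y2 h1 h2|//]; first by rewrite Normc.normc0.
  by rewrite (le_trans (le_normcD _ _))// lerD.
rewrite (le_trans (ler_wpM2r (tn0 n) (normc_sum _ _)))// mulr_suml.
apply: (@le_trans _ _ (\sum_(i < n.+1) B * ((a * t) ^+ (n - i) / (n - i)`!%:R))).
  apply: ler_sum => i _; rewrite Normc.normcM normc_real /c normrM normrX normrN.
  rewrite (ger0_norm (ltW a_gt0)) (@ger0_norm _ ('C(n, i)%:R))//.
  have E : 'C(n, i)%:R / n`!%:R = (i`!%:R)^-1 * ((n - i)`!%:R)^-1 :> R.
    rewrite -(bin_fact (leq_ord i)) !natrM invfM mulrA divff ?mul1r ?invfM//.
    by rewrite pnatr_eq0 -lt0n bin_gt0 leq_ord.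
  have -> : a ^+ (n - i) * 'C(n, i)%:R * normc (mm i) * (t ^+ n / n`!%:R) =
     (t ^+ i / i`!%:R * normc (mm i)) * ((a * t) ^+ (n - i) / (n - i)`!%:R).
    rewrite -[in t ^+ n](subnKC (leq_ord i)) exprD exprMn.
    transitivity (('C(n, i)%:R / n`!%:R) *
        (a ^+ (n - i) * normc (mm i) * (t ^+ i * t ^+ (n - i)))).
      by ring.
    by rewrite E; ring.
  by rewrite ler_wpM2r// divr_ge0// exprn_ge0// mulr_ge0// ltW.
rewrite -mulr_sumr ler_wpM2l//.
have -> : \sum_(i < n.+1) (a * t) ^+ (n - i) / (n - i)`!%:R =
    \sum_(i < n.+1) (a * t) ^+ i / i`!%:R.
  rewrite [RHS](reindex_inj rev_ord_inj); apply: eq_bigr => i _ /=.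
  by rewrite subSS.
by rewrite expR_partial_sum_le// mulr_ge0// ltW.
Qed.

(** For even n the power (iX)^n is X^n up to sign, so the modulus of its expectation is an
    absolute moment; odd powers would give the vanishing odd moments of X. *)
Lemma even_moment_le t B k : 0 <= t -> 0 <= B ->
  (forall k, normc (moment_term X a t k) <= B) ->
  Rintegral P setT (fun w => `|X w| ^+ k.*2) * (t ^+ k.*2 / k.*2`!%:R) <= B * expR (a * t).
Proof.
move=> t0 B0 mB; apply: le_trans (imaginary_moment_le t B k.*2 t0 B0 mB).
rewrite ler_wpM2r ?divr_ge0 ?exprn_ge0//.
apply: le_trans (le_Re_normc _).
have E w : Re ((0 +i* X w) ^+ k.*2) = (-1) ^+ k * `|X w| ^+ k.*2.
  have -> : (0 +i* X w) ^+ k.*2 = ((-1) ^+ k * `|X w| ^+ k.*2)%:C.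
    rewrite -mul2n !exprM real_normK ?num_real// -exprMn rmorphXn; congr (_ ^+ k).
    by rewrite [LHS]expr2; apply: complex_ext => /=; ring.
  by [].
have -> : Re (cintegral P setT (fun w => (0 +i* X w) ^+ k.*2)) =
    Rintegral P setT (fun w => (-1) ^+ k * `|X w| ^+ k.*2).
  by apply: eq_Rintegral => w _; exact: E.
rewrite RintegralZl//; last exact: integrable_abs_moment.
by rewrite normrM normrX normrN1 expr1n mul1r ler_norm.
Qed.

(** The even terms of the exponential series, doubled: they sum to 2 cosh y. *)
Let e (y : R) (k : nat) : R := exp_coeff y k + exp_coeff (- y) k.

Lemma exp_coeff_evenE y k : e y k = if odd k then 0 else 2 * (y ^+ k / k`!%:R).
Proof.
rewrite /e /exp_coeff /= exprNn -signr_odd; case: odd => /=.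
  by rewrite expr1 mulN1r mulNr subrr.
by rewrite expr0 mul1r mulr_natl mulr2n.
Qed.

(** Bound e^y by 2 cosh y, whose series only involves even moments; these are
    dominated by a geometric series of ratio t / u. *)
Lemma exp_moment_lty t u B : 0 <= t -> t < u -> 0 <= B ->
  (forall k, normc (moment_term X a u k) <= B) ->
  ('E_P[(fun w => expR (t * `|X w|))%R] < +oo)%E.
Proof.
move=> t0 tu B0 mB; have u0 : 0 < u by exact: le_lt_trans tu.
pose r := t / u; have r0 : 0 <= r by rewrite divr_ge0// ltW.
have r1 : r < 1 by rewrite ltr_pdivrMr// mul1r.
have e0 y k : 0 <= y -> 0 <= e y k.
  move=> y0; rewrite exp_coeff_evenE; case: ifP => // _.
  by rewrite mulr_ge0// divr_ge0// exprn_ge0.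
have tX0 w : 0 <= t * `|X w| by rewrite mulr_ge0.
have mE k : measurable_fun setT (fun w => (e (t * `|X w|) k)%:E).
  apply/measurable_EFinP; under eq_fun do rewrite exp_coeff_evenE.
  case: odd => /=; first exact: measurable_cst.
  apply: measurable_funM; first exact: measurable_cst.
  apply: measurable_funM; last exact: measurable_cst.
  by apply: measurable_funX; apply: measurable_funM => //; exact: measurableT_comp.
have expE w : ((expR (t * `|X w|))%:E <= \sum_(k <oo) (e (t * `|X w|) k)%:E)%E.
  set y := t * `|X w|.
  have cv : series (e y) @ \oo --> expR y + expR (- y).
    have -> : series (e y) = series (exp_coeff y) + series (exp_coeff (- y)).
      by apply/funext => n; rewrite /series /= fctE big_split.
    by apply: cvgD; exact: is_cvg_series_exp_coeff.
  have : (fun n => (\sum_(0 <= k < n) (e y k)%:E)%E) @ \oo --> (expR y + expR (- y))%:E.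
    under eq_fun do rewrite sumEFin.
    by apply: cvg_EFin => //; exact: nearW.
  by move=> /cvg_lim -> //; rewrite lee_fin lerDl expR_ge0.
rewrite unlock.
apply: (@le_lt_trans _ _ (\int[P]_w (\sum_(k <oo) (e (t * `|X w|) k)%:E))%E).
  apply: ge0_le_integral => //.
  - apply/measurable_EFinP; apply: measurableT_comp => //.
    by apply: measurable_funM => //; exact: measurableT_comp.
  - by apply: ge0_emeasurable_sum => // k w _ _; rewrite lee_fin e0.
rewrite integral_nneseries//; last by move=> k w _; rewrite lee_fin e0.
pose C := 2 * (B * expR (a * u)).
have C0 : 0 <= C by rewrite mulr_ge0// mulr_ge0// expR_ge0.
have term k : (\int[P]_w (e (t * `|X w|) k)%:E <= (C * r ^+ k)%:E)%E.
  have [ok|ek] := boolP (odd k).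
    under eq_integral do rewrite exp_coeff_evenE ok.
    by rewrite integral0 lee_fin mulr_ge0// exprn_ge0.
  have kE : k = (k./2).*2 by rewrite -[LHS]odd_double_half (negbTE ek).
  have cE w : e (t * `|X w|) k = (2 * (t ^+ k / k`!%:R)) * `|X w| ^+ k.
    by rewrite exp_coeff_evenE (negbTE ek) exprMn; ring.
  have iX := integrable_abs_moment _ _ _ _ X X_mom k.
  under eq_integral do rewrite cE EFinM.
  rewrite integralZl// -[X in (_ * X)%E]fineK; last exact: integrable_fin_num.
  rewrite -EFinM lee_fin.
  have := even_moment_le u B k./2 (ltW u0) B0 mB; rewrite -kE => h.
  have tE : t ^+ k = r ^+ k * u ^+ k by rewrite -exprMn /r divfK// gt_eqF.
  have -> : 2 * (t ^+ k / k`!%:R) * fine (\int[P]_x (`|X x| ^+ k)%:E)%E =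
     2 * (Rintegral P setT (fun w => `|X w| ^+ k) * (u ^+ k / k`!%:R)) * r ^+ k.
    by rewrite tE /Rintegral; ring.
  by rewrite ler_wpM2r ?exprn_ge0// /C ler_wpM2l.
apply: (@le_lt_trans _ _ (C / (1 - r))%:E); last exact: ltry.
apply: lime_le.
  by apply: is_cvg_nneseries => k _ _; apply: integral_ge0 => w _; rewrite lee_fin e0.
apply: nearW => n; apply: (@le_trans _ _ (\sum_(0 <= k < n) (C * r ^+ k)%:E)%E).
  by apply: lee_sum => k _.
rewrite sumEFin lee_fin -mulr_sumr ler_wpM2l//.
have : (1 - r) * (\sum_(0 <= k < n) r ^+ k) = 1 - r ^+ n.
  elim: n => [|n ih]; first by rewrite big_geq// mulr0 expr0 subrr.
  by rewrite big_nat_recr//= mulrDr ih exprS; ring.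
rewrite -[leRHS]mul1r ler_pdivlMr ?subr_gt0// mulrC => ->.
by rewrite lerBlDr lerDl exprn_ge0.
Qed.

End radius.

(** * Convergence at the end point *)

Section boundary.
Context (d : measure_display) (T : measurableType d) (R : realType).
Variables (P : probability T R) (X : {RV P >-> R}) (a : R).
Hypothesis a_gt0 : 0 < a.
Hypothesis X_sym : symmetric_RV X.
Hypothesis X_mom : finite_moments X.
Local Notation Re := (@complex.Re R).
Local Notation Im := (@complex.Im R).
Local Notation normc := (@Normc.normc R).

Let f (t : R) : R[i] := (expR (- a * t))%:C * char_fun X t.

(** e^{-uz} - e^{-tz} = e^{-tz} (e^{-(u-t)z} - 1), and the second factor is the Taylor
    remainder of order 1. *)
Lemma laplace_lipschitz t u : 0 <= t -> t <= u ->
  normc (f u - f t) <= 2 * ((u - t) * shift_moment X a 1).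
Proof.
move=> t0 tu; have u0 := le_trans t0 tu.
rewrite /f !laplace_char_fun//.
have -> : cexpectation P (fun w => cexp (- (u%:C * (a +i* X w)))) -
    cexpectation P (fun w => cexp (- (t%:C * (a +i* X w)))) =
    cintegral P setT (fun w => cexp (- (u%:C * (a +i* X w))) +
      (-1) * cexp (- (t%:C * (a +i* X w)))).
  have i1 := cexp_bound_cintegrable _ _ _ P X a a_gt0 u u0.
  have i2 := cexp_bound_cintegrable _ _ _ P X a a_gt0 t t0.
  by rewrite cintegralD//; [rewrite cintegralZ// mulN1r|exact: cintegrableZ].
have ib : P.-integrable setT (EFin \o (fun w => (u - t) * (a + `|X w|) ^+ 1)).
  exact: (integrableZl _ (u - t) (integrable_shift_power _ _ _ _ X a a_gt0 X_mom 1)).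
have kb w : setT w ->
    normc (cexp (- (u%:C * (a +i* X w))) + (-1) * cexp (- (t%:C * (a +i* X w)))) <=
    (u - t) * (a + `|X w|) ^+ 1.
  move=> _; set z := a +i* X w.
  have -> : cexp (- (u%:C * z)) + -1 * cexp (- (t%:C * z)) =
      cexp (- (t%:C * z)) * cexp_rem (- z) 1 (u - t).
    rewrite /cexp_rem big_ord_recl big_ord0 !expr0 fact0 divr1 addr0 mulr1 mulrBr mulr1 -cexpD.
    rewrite mulN1r; congr (cexp _ - _); rewrite rmorphB /=; ring.
  rewrite Normc.normcM -[leRHS]mul1r ler_pM ?normc_ge0//.
    by rewrite normc_cexp -expR0 ler_expR /= mul0r subr0 oppr_le0 mulr_ge0// ltW.
  apply: le_trans (cexp_rem_le _ _ _ _ _) _.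
  - by rewrite /= oppr_le0 ltW.
  - by rewrite subr_ge0.
  - rewrite normc_opp mulrC divr1 expr1 ler_wpM2l ?subr_ge0//.
    exact: normc_shift_power_le.
have ii : cintegrable P setT (fun w =>
    cexp (- (u%:C * (a +i* X w))) + (-1) * cexp (- (t%:C * (a +i* X w)))).
  apply: cintegrableD => //; first exact: cexp_bound_cintegrable.
  by apply: cintegrableZ => //; exact: cexp_bound_cintegrable.
rewrite (le_trans (normc_cintegral_le _ _ P setT measurableT _ _ ii ib kb))//.
by rewrite RintegralZl//; exact: integrable_shift_power.
Qed.

(** Stated for a contracting additive functional c in order to serve the real and the imaginary
    parts alike. *)
Lemma laplace_radial_cvg t (c : R[i] -> R) : 0 <= t ->
  (forall x y, c (x - y) = c x - c y) -> (forall x, `|c x| <= normc x) ->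
  c (f (r * t)) @[r --> 1^'-] --> c (f t).
Proof.
move=> t0 cB cle; set K := shift_moment X a 1.
have K0 : 0 <= K by apply: Rintegral_ge0 => w _; rewrite exprn_ge0// addr_ge0// ltW.
apply/cvgrPdist_le => e e0; near=> r.
have r0 : 0 <= r by near: r; apply: nbhs_left_ge.
have r1 : r <= 1 by near: r; apply: nbhs_left_le.
rewrite -cB (le_trans (cle _))// (le_trans (laplace_lipschitz _ _ _ _))//.
- by rewrite mulr_ge0.
- by rewrite ler_piMl.
have : 1 - r <= e / (2 * (t * K) + 1).
  rewrite lerBlDl -lerBlDr; near: r; apply: nbhs_left_ge.
  by rewrite ltrBlDr ltrDl divr_gt0// ltr_wpDl// mulr_ge0// mulr_ge0.
have tK : 0 <= t * K by rewrite mulr_ge0.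
rewrite ler_pdivlMr ?ltr_wpDl ?mulr_ge0// -/K; nra.
Unshelve. all: by end_near. Qed.

Lemma moment_termM t r n : moment_term X a (r * t) n = (r ^+ n)%:C * moment_term X a t n.
Proof.
rewrite !moment_termE mulrA -rmorphM /= -mulrN exprMn; congr (_%:C * _).
by rewrite mulrA.
Qed.

(** Abel's theorem applied to each component along the radius r |-> r t: inside the radius the
    sum is known, and the Laplace transform is continuous at t. *)
Lemma moment_series_limit t : 0 <= t -> cvgn (series (moment_term X a t)) ->
  series (moment_term X a t) @ \oo --> (f t : R[i]^o).
Proof.
rewrite le_eqVlt => /predU1P[<- _|t0 cv].
  apply: moment_series_cvg => //.
  have -> : (fun w => expR (0 * `|X w|)) = cst 1 by apply/funext => w; rewrite mul0r expR0.
  by rewrite expectation_cst ltry.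
have [B B0 mB] := cvg_moment_series_bounded _ _ _ _ X a _ cv.
pose l := limn (series (moment_term X a t)).
have cl : series (moment_term X a t) @ \oo --> l by [].
have sub r : 0 < r < 1 -> series (moment_term X a (r * t)) @ \oo --> (f (r * t) : R[i]^o).
  move=> /andP[r0 r1]; have rt0 : 0 <= r * t by rewrite mulr_ge0// ltW.
  apply: moment_series_cvg => //.
  by apply: (exp_moment_lty _ _ _ _ X a a_gt0 X_mom _ t B) => //; rewrite gtr_pMl.
suff <- : l = f t by [].
have [cr ci] := cvg_Re_Im _ _ cl.
have abel (c : R[i] -> R) : (forall x y, c (x - y) = c x - c y) ->
    (forall x, `|c x| <= normc x) ->
    series (fun k => c (moment_term X a t k)) @ \oo --> c l ->
    (forall r, 0 < r < 1 ->
      series (fun k => c (moment_term X a t k) * r ^+ k) @ \oo --> c (f (r * t))) ->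
    c l = c (f t).
  move=> cB cle c1 c2; have A := abel_limit _ _ (fun r => c (f (r * t))) c1 c2.
  exact: (cvg_unique _ A (laplace_radial_cvg _ _ (ltW t0) cB cle)).
apply: complex_ext.
- apply: abel; [by move=> x y; rewrite ReD ReN|exact: le_Re_normc| |].
  + have -> : series (fun k => Re (moment_term X a t k)) =
        (fun n => Re (series (moment_term X a t) n)).
      by apply/funext => n; rewrite series_Re.
    exact: cr.
  + move=> r /sub /cvg_Re_Im [+ _]; apply: cvg_trans; apply: near_eq_cvg; apply: nearW => n.
    rewrite series_Re; congr (series _ n); apply/funext => k.
    by rewrite moment_termM ReM /= mul0r subr0 mulrC.
- apply: abel; [by move=> x y; rewrite ImD ImN|exact: le_Im_normc| |].
  + have -> : series (fun k => Im (moment_term X a t k)) =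
        (fun n => Im (series (moment_term X a t) n)).
      by apply/funext => n; rewrite series_Im.
    exact: ci.
  + move=> r /sub /cvg_Re_Im [_ +]; apply: cvg_trans; apply: near_eq_cvg; apply: nearW => n.
    rewrite series_Im; congr (series _ n); apply/funext => k.
    by rewrite moment_termM ImM /= mul0r addr0 mulrC.
Qed.

End boundary.

Theorem theorem3p1 (d : measure_display) (T : measurableType d) (R : realType)
    (P : probability T R) (X : {RV P >-> R})
    (X_sym : symmetric_RV X) (X_mom : finite_moments X)
    (a : R) (a_gt0 : 0 < a) :
  (forall s : R[i], 0 < complex.Re s ->
    [/\ cintegrable (@lebesgue_measure R) `]0, +oo[
          (fun t => cpow t%:C (s - 1) * (expR (- a * t))%:C * char_fun X t),
        cintegrable P setT (fun w => cpow (a +i* X w) (- s)) &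
        cintegral (@lebesgue_measure R) `]0, +oo[
          (fun t => cpow t%:C (s - 1) * (expR (- a * t))%:C * char_fun X t)
        = cGamma s * cexpectation P (fun w => cpow (a +i* X w) (- s))]) /\
  [/\ forall t : R, 0 <= t -> cvgn (series (moment_term X a t)) ->
        series (moment_term X a t) @ \oo -->
          ((expR (- a * t))%:C * char_fun X t : R[i]^o),
      forall t : R, 0 <= t -> ('E_P[(fun w => expR (t * `|X w|))%R] < +oo)%E ->
        cvgn (series (moment_term X a t)) &
      forall N : nat, exists C : R, \forall t \near 0^'+,
        `|(expR (- a * t))%:C * char_fun X t - series (moment_term X a t) N|
          <= (C * t ^+ N)%:C].
Proof.
split.
  move=> s s0; have [i1 i2] := mellin_char_fun _ _ _ P X a a_gt0 s X_sym s0.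
  by split => //; exact: cintegrable_cpow.
split.
- by move=> t t0 cv; exact: moment_series_limit.
- move=> t t0 Et; apply: cvgP; exact: (moment_series_cvg _ _ _ _ X a a_gt0 X_sym X_mom t t0 Et).
- exact: moment_asymptotics.
Qed.
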